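(* Consider the system $\dot{\boldsymbol{x}}=f(\boldsymbol{x})+g(\boldsymbol{x})\boldsymbol{u}+\boldsymbol{w}$ with state $\boldsymbol{x}\in\mathbb{R}^n$, initial condition $\boldsymbol{x}(0)=\boldsymbol{x}_0$, input $\boldsymbol{u}\in\mathbb{R}^m$ and additive noise $\boldsymbol{w}\in\mathcal{W}$, where $\mathcal{W}\subset\mathbb{R}^n$ is a bounded set, and let $\phi$ be an atomic temporal formula, i.e. $\phi=G_{[a,b]}\psi$ or $\phi=F_{[a,b]}\psi$ with $\psi$ a non-temporal formula. Assume: (A1) $f:\mathbb{R}^n\to\mathbb{R}^n$ and $g:\mathbb{R}^n\to\mathbb{R}^{n\times m}$ are locally Lipschitz continuous, and $g(\boldsymbol{x})g^T(\boldsymbol{x})$ is positive definite for all $\boldsymbol{x}\in\mathbb{R}^n$; (A2) in the robustness $\rho^\psi$, the non-smooth conjunction $\min(\rho^{\psi_1},\rho^{\psi_2})$ is approximated by the smooth function $-\ln\big(\exp(-\rho^{\psi_1})+\exp(-\rho^{\psi_2})\big)$; (A3) $\psi$ is such that 1) $\rho^\psi(\boldsymbol{x})$ is concave and 2) $\psi$ is well-posed in the sense that $(\boldsymbol{x},0)\models\psi$ implies $\|\boldsymbol{x}(0)\|<\infty$; (A4) $\rho^\psi_{opt}:=\sup_{\boldsymbol{x}\in\mathbb{R}^n}\rho^\psi(\boldsymbol{x})>0$. Let $\gamma(t):=(\gamma_0-\gamma_\infty)\exp(-lt)+\gamma_\infty$ with $\gamma_0,\gamma_\infty\in\mathbb{R}_{>0}$,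 $\gamma_0\ge\gamma_\infty$ and $l\in\mathbb{R}_{\ge0}$, and define $$\xi(\boldsymbol{x},t):=\frac{\rho^\psi(\boldsymbol{x})-\rho_{max}}{\gamma(t)},\qquad \epsilon(\boldsymbol{x},t):=\ln\Big(-\frac{\xi(\boldsymbol{x},t)+1}{\xi(\boldsymbol{x},t)}\Big).$$ If $\xi(\boldsymbol{x}_0,0)\in(-1,0)$ and $\rho_{max}\in\big(\max(0,\rho^\psi(\boldsymbol{x}_0)),\rho^\psi_{opt}\big)$, then the control law $$\boldsymbol{u}(\boldsymbol{x},t):=-\epsilon(\boldsymbol{x},t)\,g^T(\boldsymbol{x})\,\frac{\partial\rho^\psi(\boldsymbol{x})}{\partial\boldsymbol{x}}$$ guarantees that $$-\gamma(t)+\rho_{max}<\rho^\psi(\boldsymbol{x}(t))<\rho_{max}$$ is satisfied for all $t\in\mathbb{R}_{\ge0}$, with all closed-loop signals being well-posed, i.e., continuous and bounded.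
   Context: A predicate $\mu$ is given by a function $h:\mathbb{R}^n\to\mathbb{R}$; it is true at $\boldsymbol{x}\in\mathbb{R}^n$ iff $h(\boldsymbol{x})\ge0$. Non-temporal formulas are generated by $\psi::=\top\mid\mu\mid\neg\mu\mid\psi_1\wedge\psi_2$. For a signal $\boldsymbol{x}:\mathbb{R}_{\ge0}\to\mathbb{R}^n$, $(\boldsymbol{x},t)\models\psi$ means that $\psi$ is true at $\boldsymbol{x}(t)$. The operators $G_{[a,b]}$ (always) and $F_{[a,b]}$ (eventually), with $a\le b$ in $\mathbb{R}_{\ge0}\cup\{\infty\}$, require $\psi$ to hold at all, respectively some, times in $[t+a,t+b]$. Robustness of non-temporal formulas, with the approximation of (A2): $\rho^\mu(\boldsymbol{x}):=h(\boldsymbol{x})$, $\rho^{\neg\mu}(\boldsymbol{x}):=-h(\boldsymbol{x})$, and $\rho^{\psi_1\wedge\psi_2}(\boldsymbol{x}):=-\ln\big(\exp(-\rho^{\psi_1}(\boldsymbol{x}))+\exp(-\rho^{\psi_2}(\boldsymbol{x}))\big)$; by convention $\rho^\top=+\infty$. The gradient $\partial\rho^\psi/\partial\boldsymbol{x}$ is a column vector, and $\boldsymbol{x}(t)$ in the conclusion is the closed-loop solution.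
   Formalization: Well-posedness in (A3) is taken as a uniform bound: some C has ‖x(0)‖ ≤ C whenever (x,0) satisfies ψ. Read literally, ‖x(0)‖ < ∞ always holds and boundedness can fail, e.g. ρ = x₁, f = (0,1), g = I, w = 0. Differentiability of ρ and measurability of w are explicit. *)

(* Defs.v *)
From HB Require Import structures.
From mathcomp Require Import all_boot all_order all_algebra.
From mathcomp Require Import all_classical all_reals all_analysis.

Set Implicit Arguments.
Unset Strict Implicit.
Unset Printing Implicit Defensive.

Import Order.TTheory GRing.Theory Num.Theory.
Import numFieldNormedType.Exports.

Local Open Scope classical_set_scope.
Local Open Scope ring_scope.

(* R^n is the type 'cV[R]_n of column vectors with the library's (sup-) norm.
   Boundedness, Lipschitz continuity and differentiability do not depend on
   the choice of the norm. Signals are functions on R of which only the values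
   at times t >= 0 are used. *)

Section Formulas.
Variables (R : realType) (n : nat).

(* A predicate is identified with its function h. *)
Inductive formula :=
| FTrue
| FPred (h : 'cV[R]_n -> R)
| FNegPred (h : 'cV[R]_n -> R)
| FAnd (psi1 psi2 : formula).

Fixpoint holds (psi : formula) (x : 'cV[R]_n) : Prop :=
  match psi with
  | FTrue => True
  | FPred h => 0 <= h x
  | FNegPred h => ~ (0 <= h x)
  | FAnd psi1 psi2 => holds psi1 x /\ holds psi2 x
  end.

Definition sat (x : R -> 'cV[R]_n) (t : R) (psi : formula) := holds psi (x t).

(* The interval bounds range over the nonnegative extended reals; when b = +oo
   the operators range over all real times s >= t + a. *)
Inductive temporal :=
| Always (a b : \bar R) (psi : formula)
| Eventually (a b : \bar R) (psi : formula).

Definition window (a b : \bar R) (t : R) : set R :=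
  [set s | (t%:E + a <= s%:E <= t%:E + b)%E].

Definition tsat (x : R -> 'cV[R]_n) (t : R) (phi : temporal) : Prop :=
  match phi with
  | Always a b psi => forall s, window a b t s -> sat x s psi
  | Eventually a b psi => exists2 s, window a b t s & sat x s psi
  end.

(* The robustness of FTrue is +oo, and [expeR], [lne] are the extensions of exp
   and ln to the extended reals, so that FTrue is neutral for the smooth
   conjunction: exp(-oo) = 0 and - ln 0 = +oo. Hence [rho psi] is either finite
   everywhere or constantly +oo. *)
Fixpoint rho (psi : formula) (x : 'cV[R]_n) : \bar R :=
  match psi with
  | FTrue => +oo%E
  | FPred h => (h x)%:E
  | FNegPred h => (- h x)%:E
  | FAnd psi1 psi2 =>
      (- lne (expeR (- rho psi1 x) + expeR (- rho psi2 x)))%E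
  end.

Definition rho_fin (psi : formula) (x : 'cV[R]_n) : R := fine (rho psi x).

Definition rho_opt (psi : formula) : \bar R := ereal_sup (range (rho psi)).

Definition concave (F : 'cV[R]_n -> \bar R) :=
  forall (x y : 'cV[R]_n) (t : R), 0 <= t <= 1 ->
    (t%:E * F x + (1 - t)%:E * F y <= F (t *: x + (1 - t) *: y)%R)%E.

(* Every single vector of R^n has finite norm, so "(x,0) |= psi implies
   ||x(0)|| < oo" is read with a bound that does not depend on the signal. *)
Definition well_posed (psi : formula) :=
  exists C : R, forall x : R -> 'cV[R]_n, sat x 0 psi -> `|x 0| <= C.

End Formulas.

Arguments FTrue {R n}.

Definition posdef (R : realType) (n : nat) (A : 'M[R]_n) :=
  A^T = A /\ forall v : 'cV[R]_n, v != 0 -> 0 < (v^T *m A *m v) 0 0.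

Definition grad (R : realType) (n : nat) (F : 'cV[R]_n -> R) (x : 'cV[R]_n) :
    'cV[R]_n :=
  \col_i 'D_(delta_mx i 0) F x.

Section Control.
Variables (R : realType) (n m : nat).
Variables (f : 'cV[R]_n -> 'cV[R]_n) (g : 'cV[R]_n -> 'M[R]_(n, m)).
Variables (psi : formula R n) (rho_max gamma0 gammaoo l : R).

Definition gamma (t : R) : R := (gamma0 - gammaoo) * expR (- l * t) + gammaoo.

Definition xi (x : 'cV[R]_n) (t : R) : R :=
  (rho_fin psi x - rho_max) / gamma t.

(* [ln] is 0 on nonpositive reals, hence so is epsilon when xi is not in
   ]-1, 0[. *)
Definition epsilon (x : 'cV[R]_n) (t : R) : R :=
  ln (- ((xi x t + 1) / xi x t)).

Definition control (x : 'cV[R]_n) (t : R) : 'cV[R]_m :=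
  - epsilon x t *: ((g x)^T *m grad (rho_fin psi) x).

(* [closed_loop_solution w x0 J x]: on the time interval J (of the form [0, T[
   or [0, +oo[), x is a Caratheodory solution of
     x' = f(x) + g(x) u(x, t) + w(t),  x(0) = x0,
   in integral form. The noise w is only measurable, so the equation cannot be
   required at every time; if w is continuous on J and the closed-loop field is
   continuous along x, x is a classical solution. Membership of xi in ]-1, 0[
   along x is deliberately not part of the definition. *)
Definition closed_loop_solution (w : R -> 'cV[R]_n) (x0 : 'cV[R]_n)
    (J : set R) (x : R -> 'cV[R]_n) :=
  let v s := f (x s) + g (x s) *m control (x s) s + w s in
  [/\ x 0 = x0,
      {within J, continuous x} &
      forall t, J t -> forall i : 'I_n,
        lebesgue_measure.-integrable `[0, t] (fun s => (v s i 0)%:E) /\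
        x t i 0 = x0 i 0 + \int[lebesgue_measure]_(s in `[0, t]) v s i 0].

End Control.

Definition noise (R : realType) (n : nat) (W : set 'cV[R]_n)
    (w : R -> 'cV[R]_n) :=
  (forall t, 0 <= t -> W (w t)) /\
  forall i : 'I_n,
    measurable_fun (`[0, +oo[%classic : set R) (fun t : R => w t i 0).

Definition continuous_and_bounded (R : realType) (V : normedModType R)
    (s : R -> V) :=
  {within (`[0, +oo[%classic : set R), continuous s} /\
  [bounded s t | t in (`[0, +oo[%classic : set R)].

(* Main.v *)
(* Let r be the robustness of psi. A concave differentiable function is C^1, its
   superlevel sets are compact (one of them is bounded by well-posedness), and its
   gradient vanishes nowhere on r <= rho_max < rho_opt. Hence on the compact set
   K = {rho_max - gamma0 <= r <= rho_max} the gain |g^T grad r|^2 is bounded away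
   from 0, and the drift, the noise and the contraction rate of the funnel are
   dominated by |epsilon| |g^T grad r|^2 as soon as |epsilon| is large: xi can
   leave neither the bound -1 + eta nor the bound - eta, for a small eta. This is
   proved by induction on the real time, from the sign of a one-sided derivative
   of r along the solution at the times where xi reaches a bound.
   The gradient need not be Lipschitz, so solutions may fail to be unique and the
   Picard-Lindelof theorem does not apply. Existence is Caratheodory's theorem
   (delayed approximations, Tychonoff compactness, dominated convergence) for the
   field truncated to a box around K and to xi in [-1 + eta / 2, - eta / 2]; by invariance the
   truncation is never active. *)
Require Import Defs.
From HB Require Import structures.
From mathcomp Require Import all_boot all_order all_algebra.
From mathcomp Require Import all_classical all_reals all_analysis.
From mathcomp Require Import ring lra measurable_realfun.

Set Implicit Arguments.
Unset Strict Implicit.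
Unset Printing Implicit Defensive.

Import Order.TTheory GRing.Theory Num.Theory.
Import numFieldNormedType.Exports.

Local Open Scope classical_set_scope.
Local Open Scope ring_scope.

(** * Matrices and integrals over intervals *)

Lemma normr_entry_le (R : realType) m n (M : 'M[R]_(m, n)) i j :
  `|M i j| <= `|M|.
Proof.
rewrite [leRHS]/Num.norm /= mx_normrE; apply/bigmax_geP; right => /=.
by exists (i, j).
Qed.

Lemma normr_mx_le (R : realType) m n (M : 'M[R]_(m, n)) e : 0 <= e ->
  (forall i j, `|M i j| <= e) -> `|M| <= e.
Proof.
move=> e0 Me; rewrite [leLHS]/Num.norm /= mx_normrE.
by apply/bigmax_leP; split => // -[i j] _; exact: Me.
Qed.

(** A basic neighbourhood of a matrix is a product of neighbourhoods of its finitely many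
    entries. *)
Lemma cvg_mx (R : realType) (T : Type) (F : set_system T) (FF : Filter F) m n
    (M : T -> 'M[R]_(m, n)) (L : 'M[R]_(m, n)) :
  (forall i j, M t i j @[t --> F] --> L i j) -> M t @[t --> F] --> L.
Proof.
move=> ML U [P LP PU]; rewrite nbhs_simpl.
have H : \forall t \near F, forall ij : 'I_m * 'I_n, P ij.1 ij.2 (M t ij.1 ij.2).
  by apply: filter_forall => -[i j]; exact: (ML i j _ (LP i j)).
by apply: filterS H => t Mt; apply: PU => i j; exact: (Mt (i, j)).
Qed.

Lemma cvg_entry (R : realType) (T : Type) (F : set_system T) (FF : Filter F) m n
    (M : T -> 'M[R]_(m, n)) (L : 'M[R]_(m, n)) i j :
  M t @[t --> F] --> L -> M t i j @[t --> F] --> L i j.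
Proof.
move=> ML; exact: (cvg_comp _ _ ML (@coord_continuous _ m n i j L)).
Qed.

Lemma cvg_mulmx (R : realType) (T : Type) (F : set_system T) (FF : Filter F)
    m n p (M : T -> 'M[R]_(m, n)) (N : T -> 'M[R]_(n, p))
    (L : 'M[R]_(m, n)) (K : 'M[R]_(n, p)) :
  M t @[t --> F] --> L -> N t @[t --> F] --> K ->
  M t *m N t @[t --> F] --> L *m K.
Proof.
move=> ML NK; apply: cvg_mx => i j.
under eq_fun do rewrite mxE; rewrite mxE.
apply: cvg_big => [|k _]; last by apply: cvgM; exact: cvg_entry.
by move=> u; exact: add_continuous.
Qed.

Lemma cvg_trmx (R : realType) (T : Type) (F : set_system T) (FF : Filter F)
    m n (M : T -> 'M[R]_(m, n)) (L : 'M[R]_(m, n)) :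
  M t @[t --> F] --> L -> (M t)^T @[t --> F] --> L^T.
Proof.
move=> ML; apply: cvg_mx => i j.
under eq_fun do rewrite mxE; rewrite mxE; exact: cvg_entry.
Qed.

(** Heine-Borel is applied to the row vectors [u] with [A u^T]; transposition is continuous and
    preserves the norm. *)
Lemma compact_cV (R : realType) n (A : set 'cV[R]_n) :
  bounded_set A -> closed A -> compact A.
Proof.
move=> bA cA.
have tC k l : continuous (@trmx R k l) by move=> x; apply: (@cvg_trmx _ _ (nbhs x) _ k l id x); exact: cvg_id.
rewrite (_ : A = trmx @` [set u | A u^T]).
  apply: continuous_compact; first exact/continuous_subspaceT/tC.
  apply: bounded_closed_compact.
    move: bA => [M [Mr HM]]; exists M; split => // N MN u Au.
    apply: le_trans (HM _ MN _ Au).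
    apply: normr_mx_le => // i j; have := normr_entry_le u^T j i; by rewrite mxE.
  by apply: (preimage_closed _ cA) => x _; exact: tC.
apply/seteqP; split => [x Ax|_ [u Au <-]//]; exists x^T; last by rewrite trmxK.
by rewrite /= trmxK.
Qed.

(** * Bounds on integrals over intervals and on primitives *)

Section scalar_integrals.
Variable R : realType.
Notation mu := (@lebesgue_measure R).
Implicit Types (V : R -> R) (a b c B t : R).

Lemma lebesgue_measure_cc a b : a <= b -> mu `[a, b] = (b - a)%:E.
Proof.
rewrite le_eqVlt => /predU1P[->|ab].
  by rewrite set_itv1 lebesgue_measure_set1 subrr.
by rewrite lebesgue_measure_itv/= lte_fin ab EFinB.
Qed.

Lemma integrable_bounded V a b B : measurable_fun (`[a, b]%classic : set R) V ->
  (forall s, a <= s <= b -> `|V s| <= B) ->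
  mu.-integrable `[a, b] (fun s => (V s)%:E).
Proof.
move=> mV VB; apply: measurable_bounded_integrable => //=.
  have [ab|ab] := leP a b; first by rewrite lebesgue_measure_cc// ltry.
  by rewrite set_itv_ge ?measure0// bnd_simp -ltNge.
exists B; split; first exact: num_real.
by move=> M BM s /=; rewrite in_itv/= => sab; exact: le_trans (VB _ sab) (ltW BM).
Qed.

Lemma Rintegral_le V a b c : a <= b ->
  mu.-integrable `[a, b] (fun s => (V s)%:E) ->
  (forall s, a <= s <= b -> V s <= c) ->
  \int[mu]_(s in `[a, b]) V s <= c * (b - a).
Proof.
move=> ab iV Vc.
rewrite (_ : b - a = fine (mu `[a, b])); last by rewrite lebesgue_measure_cc.
rewrite -Rintegral_cst//; apply: le_Rintegral => //.
  by apply: (@integrable_bounded (cst c) _ _ `|c|) => // s _; exact: lexx.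
Qed.

Lemma Rintegral_increment V a b : 0 <= a -> a <= b ->
  mu.-integrable `[0, b] (fun s => (V s)%:E) ->
  \int[mu]_(s in `[0, b]) V s - \int[mu]_(s in `[0, a]) V s =
  \int[mu]_(s in `[a, b]) V s.
Proof.
move=> a0 ab iV; rewrite Rintegral_itvB// ?bnd_simp// Rintegral_itv_obnd_cbnd//.
by apply: integrableS iV => // s /=; rewrite !in_itv/= => /andP[/ltW as_ ->];
  rewrite (le_trans a0).
Qed.

(** For a negative upper limit the interval is empty and the integral is 0, so the primitive is
    constant on negative times and the estimate holds on the whole line. The delayed approximations
    evaluate it at such times. *)
Lemma primitive_lipschitz V B : 0 <= B -> measurable_fun (`[0, +oo[%classic : set R) V ->
  (forall s, 0 <= s -> `|V s| <= B) ->
  forall a b, `|\int[mu]_(s in `[0, b]) V s - \int[mu]_(s in `[0, a]) V s| <=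
    B * `|b - a|.
Proof.
move=> B0 mV VB.
have iV t s : 0 <= s -> mu.-integrable `[s, t] (fun r => (V r)%:E).
  move=> s0; apply: (@integrable_bounded _ _ _ B).
    apply: measurable_funS mV => // r /=; rewrite !in_itv/= andbT => /andP[+ _].
    exact: le_trans.
  by move=> r /andP[sr _]; apply: VB; exact: le_trans sr.
have H a b : a <= b ->
    `|\int[mu]_(s in `[0, b]) V s - \int[mu]_(s in `[0, a]) V s| <= B * `|b - a|.
  move=> ab; rewrite (ger0_norm (x := b - a)) ?subr_ge0//.
  have normP s t : 0 <= s -> s <= t ->
      `|\int[mu]_(r in `[s, t]) V r| <= B * (t - s).
    move=> s0 st; apply: le_trans (le_normr_Rintegral _ (iV _ _ s0)) _ => //.
    apply: Rintegral_le => //.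
      apply: (@integrable_bounded _ _ _ B).
        apply: measurableT_comp => //; apply: measurable_funS mV => // r /=.
        rewrite !in_itv/= andbT => /andP[+ _]; exact: le_trans.
      by move=> r /andP[sr _]; rewrite normr_id; apply: VB; exact: le_trans sr.
    by move=> r /andP[sr _]; apply: VB; exact: le_trans sr.
  have [a0|a0] := leP 0 a.
    by rewrite Rintegral_increment//; [exact: normP|exact: iV].
  rewrite [X in _ - X](_ : _ = 0) ?subr0; last first.
    by rewrite set_itv_ge ?Rintegral_set0// bnd_simp -ltNge.
  have [b0|b0] := leP 0 b.
    apply: le_trans (normP _ _ (lexx 0) b0) _; rewrite ler_wpM2l// lerD2l.
    by rewrite lerN2 ltW.
  rewrite set_itv_ge ?Rintegral_set0 ?bnd_simp -?ltNge// normr0.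
  by rewrite mulr_ge0// subr_ge0.
move=> a b; have [/H//|/ltW/H] := leP a b.
by rewrite distrC [X in _ <= _ * X]distrC.
Qed.

End scalar_integrals.

(** Serves to pass between the prescribed, truncated and closed-loop fields, which agree only along
    the path and on the time interval considered. *)
Lemma eq_integral_equation (R : realType) (V U : R -> R) (t c d : R) :
  (forall s, 0 <= s <= t -> V s = U s) ->
  (@lebesgue_measure R).-integrable `[0, t] (fun s => (V s)%:E) /\
    d = c + \int[@lebesgue_measure R]_(s in `[0, t]) V s ->
  (@lebesgue_measure R).-integrable `[0, t] (fun s => (U s)%:E) /\
    d = c + \int[@lebesgue_measure R]_(s in `[0, t]) U s.
Proof.
move=> VU [iV ->]; split.
  apply: eq_integrable iV => // s /[!inE]/=; rewrite in_itv/=.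
  by move=> /VU ->.
congr (_ + _); apply: eq_Rintegral => s /[!inE]/=; rewrite in_itv/=; exact: VU.
Qed.

(** * Existence of Caratheodory solutions *)

Lemma entry_lipschitz_continuous (R : realType) m n (y : R -> 'M[R]_(m, n)) B :
  (forall a b i j, `|y b i j - y a i j| <= B * `|b - a|) -> continuous y.
Proof.
move=> yB t; apply: cvg_mx => i j; apply/cvgrPdist_lt => e e0.
have B1 : 0 < `|B| + 1 by rewrite ltr_wpDl.
near=> s; apply: le_lt_trans (yB _ _ _ _) _.
apply: (@le_lt_trans _ _ ((`|B| + 1) * `|t - s|)).
  by rewrite ler_wpM2r// (le_trans (ler_norm B))// lerDl.
rewrite -ltr_pdivlMl//; near: s.
by apply: cvgr_dist_lt; [exact: cvg_id|rewrite mulr_gt0// invr_gt0].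
Unshelve. all: by end_near. Qed.

Section caratheodory.
Variables (R : realType) (n : nat) (F : 'cV[R]_n -> R -> 'cV[R]_n).
Variables (x0 : 'cV[R]_n) (B : R).
Notation mu := (@lebesgue_measure R).
Hypothesis F_bounded : forall x s i, 0 <= s -> `|F x s i 0| <= B.
Hypothesis F_continuous : forall s, 0 <= s -> continuous (F^~ s).
Hypothesis F_measurable : forall y : R -> 'cV[R]_n, continuous y ->
  forall i, measurable_fun (`[0, +oo[%classic : set R) (fun s => F (y s) s i 0).
Hypothesis B0 : 0 <= B.

(** The Picard operator: on nonnegative times its fixed points are the solutions sought. *)
Definition integral_operator (y : R -> 'cV[R]_n) (t : R) : 'cV[R]_n :=
  \col_i (x0 i 0 + \int[mu]_(s in `[0, t]) F (y s) s i 0).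

Definition entry_lipschitz (y : R -> 'cV[R]_n) :=
  forall a b i (j : 'I_1), `|y b i j - y a i j| <= B * `|b - a|.

Lemma integral_operator_lipschitz y : continuous y -> entry_lipschitz (integral_operator y).
Proof.
move=> cy a b i j; rewrite !mxE [X in `|X|](_ : _ =
  \int[mu]_(s in `[0, b]) F (y s) s i 0 - \int[mu]_(s in `[0, a]) F (y s) s i 0).
  apply: (primitive_lipschitz B0 (F_measurable cy i)) => s; exact: F_bounded.
by rewrite opprD addrACA subrr add0r.
Qed.

Lemma integral_operator_lt0 y t : t < 0 -> integral_operator y t = x0.
Proof.
move=> t0; apply/colP => i; rewrite mxE set_itv_ge ?Rintegral_set0 ?addr0//.
by rewrite bnd_simp -ltNge.
Qed.

(** Tonelli's scheme: [j] iterations, started at [x0], towards a solution of the delayed equation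
    [y t = integral_operator y (t - h)]. *)
Fixpoint tonelli (h : R) (j : nat) : R -> 'cV[R]_n :=
  if j is j'.+1 then fun t => integral_operator (tonelli h j') (t - h) else fun=> x0.

Lemma tonelli_lipschitz h j : entry_lipschitz (tonelli h j).
Proof.
elim: j => [|j IH] a b i k /=; first by rewrite subrr normr0 mulr_ge0.
have := @integral_operator_lipschitz _ (entry_lipschitz_continuous IH) (a - h) (b - h) i k.
by rewrite opprB addrA subrK.
Qed.

Lemma tonelli_continuous h j : continuous (tonelli h j).
Proof. exact: entry_lipschitz_continuous (@tonelli_lipschitz h j). Qed.

(** The value at [t] depends only on values up to [t - h], so each iteration settles a further time
    interval of length [h]; before time 0 everything equals [x0]. *)
Lemma tonelli_fix h j t : 0 < h -> t < j%:R * h ->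
  tonelli h j.+1 t = tonelli h j t.
Proof.
move=> h0; elim: j t => [|j IH] t tj.
  by rewrite /= integral_operator_lt0// subr_lt0 (lt_trans tj)// mul0r.
rewrite [LHS]/= [RHS]/=; apply/colP => i; rewrite !mxE; congr (_ + _).
apply: eq_Rintegral => s /[!inE]/=; rewrite in_itv/= => /andP[s0 st].
rewrite -IH//; apply: le_lt_trans st _.
by rewrite ltrBlDr -[X in _ + X]mul1r -mulrDl -natr1 in tj *.
Qed.

(** With delay [1 / (k + 1)], [(k + 1)^2] iterations settle all times below [k + 1]. *)
Let h (k : nat) : R := k.+1%:R^-1.
Let z (k : nat) := tonelli (h k) (k.+1 * k.+1)%N.

Lemma approx_eq k t : t < k.+1%:R -> z k t = integral_operator (z k) (t - h k).
Proof.
move=> tk; rewrite -[RHS]/(tonelli (h k) (k.+1 * k.+1).+1%N t) tonelli_fix//.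
  by rewrite invr_gt0 ltr0n.
by rewrite natrM -mulrA mulfV ?mulr1// pnatr_eq0.
Qed.

Lemma approx_delay k t i : t < k.+1%:R -> `|z k t i 0 - integral_operator (z k) t i 0| <= B * h k.
Proof.
move=> /approx_eq ->; have := integral_operator_lipschitz (@tonelli_continuous _ _) t (t - h k) i 0.
rewrite addrAC subrr add0r normrN ger0_norm ?invr_ge0//; exact.
Qed.

(* As the z k are equi-Lipschitz, closeness at finitely many points yields
   uniform closeness on bounded intervals. *)
Lemma approx_cluster_point : exists f : R * 'I_n -> R, forall (I : finType)
  (p : I -> R * 'I_n) (e : R) (N : nat), 0 < e ->
  exists2 k, (N <= k)%N & forall q, `|z k (p q).1 (p q).2 0 - f (p q)| < e.
Proof.
pose A (p : R * 'I_n) := `[x0 p.2 0 - B * (`|p.1| + 1), x0 p.2 0 + B * (`|p.1| + 1)]%classic.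
have cA p : compact (A p) by exact: segment_compact.
pose Z (k : nat) : prod_topology (fun _ : R * 'I_n => R) :=
  fun p => z k p.1 p.2 0.
have ZA : (Z @ \oo) [set f | forall p, A p (f p)].
  exists 0%N => // k _ [t i]; rewrite /A/= in_itv/= -ler_distl.
  (* The Lipschitz bound is used from time -1, where all approximations equal [x0]; hence the radius
     [B * (|p.1| + 1)] in [A]. *)
  have zN1 : z k (-1) = x0.
    rewrite approx_eq ?integral_operator_lt0//; last exact: (lt_trans (ltrN10 R)).
    by rewrite -opprD oppr_lt0 addr_gt0// invr_gt0.
  rewrite /Z/= -zN1; apply: le_trans (tonelli_lipschitz _ _ _ _ _ _) _.
  by rewrite ler_wpM2l// opprK (le_trans (ler_normD _ _))// normr1.
have [f [Af clf]] := tychonoff cA (fmap_proper_filter Z _) ZA.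
exists f => I p e N e0.
have ZN : (Z @ \oo) [set g | exists2 k, (N <= k)%N & g = Z k].
  by exists N => // k Nk; exists k.
have nf : nbhs f [set g : prod_topology (fun _ : R * 'I_n => R) |
    forall q, `|f (p q) - g (p q)| < e].
  pose G q := [set g : prod_topology (fun _ : R * 'I_n => R) |
    `|f (p q) - g (p q)| < e].
  suff H q : nbhs f (G q).
    exact: (@filter_forall _ I G (nbhs f) (nbhs_filter f) H).
  exact: (@proj_continuous _ (fun _ : R * 'I_n => R) (p q) f _
    (nbhsx_ballx (f (p q)) _ e0)).
have [_ [[k Nk ->] kf]] := clf _ _ ZN nf.
by exists k => // q; rewrite distrC; exact: kf.
Qed.

Let h_gt0 k : 0 < h k. Proof. by rewrite invr_gt0. Qed.

Let cvg_h (u : nat -> R) (l C : R) (N : nat) :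
  (forall m, (N <= m)%N -> `|l - u m| <= C * h m) -> u @ \oo --> l.
Proof.
move=> ul; apply/cvgrPdist_le => e e0.
have : (fun m => C * h m) @ \oo --> C * 0 by apply: cvgMr; exact: cvg_harmonic.
rewrite mulr0 => /cvgrPdist_le /(_ _ e0) He.
near=> m; apply: le_trans (ul _ _) _; first by near: m; exists N.
apply: le_trans (ler_norm _) _; rewrite -normrN -sub0r; near: m; exact: He.
Unshelve. all: by end_near. Qed.

(** The cluster point inherits the Lipschitz bound and is the limit of a subsequence, uniformly on
    bounded intervals. Dominated convergence, with the constant [B] as dominating function, then
    turns the delayed equations into the integral equation. *)
Theorem caratheodory_existence : exists x : R -> 'cV[R]_n,
  [/\ x 0 = x0, continuous x &
    forall t, 0 <= t -> forall i,
      mu.-integrable `[0, t] (fun s => (F (x s) s i 0)%:E) /\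
      x t i 0 = x0 i 0 + \int[mu]_(s in `[0, t]) F (x s) s i 0].
Proof.
have [f fz] := approx_cluster_point.
pose x t : 'cV[R]_n := \col_i f (t, i).
have xlip : entry_lipschitz x.
  move=> a b i j; rewrite !mxE; apply/ler_addgt0Pr => e e0.
  (* A single index approximates the cluster point at both times, each within [e / 2]. *)
  have [k _ kf] := fz _ (fun c : bool => (if c then a else b, i)) _ 0%N
    (divr_gt0 e0 (ltr0n R 2)).
  have := kf true; have := kf false; have := tonelli_lipschitz (h k) (k.+1 * k.+1)%N a b i 0.
  rewrite /= -/(z k); move: (B * _) => D.
  rewrite ler_distl ltr_distl => /andP[? ?] /andP[? ?].
  rewrite ltr_distl => /andP[? ?]; rewrite ler_distl; apply/andP; split; lra.
have xcont := entry_lipschitz_continuous xlip.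
(* Closeness [h m] is imposed on a grid of step [h m] covering [[0, m + 1]]. Between grid points the
   Lipschitz bounds of [z k] and of [x] add [B * h m] each. *)
have zx m : exists k, (m <= k)%N /\ forall t i, 0 <= t <= m.+1%:R ->
    `|z k t i 0 - x t i 0| <= (2 * B + 1) * h m.
  have [k mk kf] := fz _ (fun q : 'I_(m.+1 * m.+1).+1 * 'I_n =>
    (q.1%:R * h m, q.2)) _ m (h_gt0 m).
  exists k; split => // t i /andP[t0 tm].
  have tm0 : 0 <= t * m.+1%:R by rewrite mulr_ge0.
  have /andP[qt tq] := truncn_itv tm0.
  set q := Num.trunc _ in qt tq.
  have qm : (q < (m.+1 * m.+1).+1)%N.
    by rewrite ltnS -(ler_nat R) (le_trans qt)// natrM ler_wpM2r.
  have := kf (Ordinal qm, i); rewrite /=.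
  have tqh : `|t - q%:R * h m| <= h m.
    rewrite ger0_norm; last by rewrite subr_ge0 ler_pdivrMr ?ltr0n.
    rewrite lerBlDr -[X in X + _]mul1r -mulrDl ler_pdivlMr ?ltr0n//.
    by rewrite addrC natr1 ltW.
  have := tonelli_lipschitz (h k) (k.+1 * k.+1)%N (q%:R * h m) t i 0; rewrite -/(z k).
  have := xlip (q%:R * h m) t i 0; rewrite !mxE.
  have := ler_wpM2l B0 tqh; move: (B * `|_|) => D.
  rewrite !ler_distl !ltr_distl => ? /andP[? ?] /andP[? ?] /andP[? ?].
  by apply/andP; split; lra.
have [K zxK] := choice zx.
have hK m : h (K m) <= h m.
  by rewrite lef_pV2 ?posrE ?ltr0n// ler_nat ltnS; case: (zxK m).
have bigN (t : R) : exists N : nat, forall m, (N <= m)%N -> t <= m.+1%:R /\ t < (K m).+1%:R.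
  exists (Num.trunc `|t|).+1 => m Nm.
  have tm : t < m.+1%:R.
    apply: le_lt_trans (ler_norm t) _; have /andP[_] := truncn_itv (normr_ge0 t).
    by move=> /lt_le_trans; apply; rewrite ler_nat ltnS; exact: ltnW.
  split; first exact: ltW.
  by apply: lt_le_trans tm _; rewrite ler_nat ltnS; case: (zxK m).
have zcvg t i : 0 <= t -> z (K m) t i 0 @[m --> \oo] --> x t i 0.
  move=> t0; have [N HN] := bigN t.
  apply: (@cvg_h _ _ (2 * B + 1) N) => m /HN[tm _].
  by rewrite distrC; have [_] := zxK m; apply; rewrite t0.
(* The further [B * h m] is the cost of the delay, since [h (K m) <= h m]. *)
have flowcvg t i : 0 <= t -> integral_operator (z (K m)) t i 0 @[m --> \oo] --> x t i 0.
  move=> t0; have [N HN] := bigN t.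
  apply: (@cvg_h _ _ (3 * B + 1) N) => m /HN[tm tK].
  have [_ /(_ t i)] := zxK m; rewrite t0 tm => /(_ isT).
  have := approx_delay i tK; have := ler_wpM2l B0 (hK m).
  rewrite !ler_distl => ? /andP[? ?] /andP[? ?]; apply/andP; split; lra.
have int_F y t i : continuous y -> mu.-integrable `[0, t] (fun s => (F (y s) s i 0)%:E).
  move=> cy; apply: (@integrable_bounded _ _ _ _ B).
    apply: measurable_funS (F_measurable cy i) => // s /=.
    by rewrite !in_itv/= andbT => /andP[].
  by move=> s /andP[s0 _]; exact: F_bounded.
have flowx t : 0 <= t -> x t = integral_operator x t.
  move=> t0; apply/colP => i.
  suff H : integral_operator (z (K m)) t i 0 @[m --> \oo] --> integral_operator x t i 0.
    by apply: (cvg_unique _ (flowcvg t i t0) H).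
  under eq_fun do rewrite mxE.
  rewrite mxE; apply: cvgD; first exact: cvg_cst.
  have := @dominated_convergence _ _ _ mu `[0, t]%classic _
    (fun m s => (F (z (K m) s) s i 0)%:E) (fun s => (F (x s) s i 0)%:E) (cst B%:E).
  case=> //.
  - move=> m; apply: (measurable_int mu); exact/int_F/tonelli_continuous.
  - apply: (measurable_int mu); exact: int_F.
  - apply: aeW => s /=; rewrite in_itv/= => /andP[s0 _].
    apply/fine_cvgP; split; first by apply: nearW => m; rewrite fin_numE.
    apply: (@cvg_entry _ _ _ _ _ _ (fun m => F (z (K m) s) s) (F (x s) s) i 0).
    have zxs : z (K m) s @[m --> \oo] --> x s.
      by apply: cvg_mx => k j; rewrite ord1; exact: zcvg.
    exact: (cvg_comp _ _ zxs (@F_continuous s s0 (x s))).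
  - by apply: (@integrable_bounded _ (cst B) _ _ `|B|).
  - apply: aeW => s m /=; rewrite in_itv/= => /andP[s0 _].
    by rewrite lee_fin; exact: F_bounded.
  - move=> iF _; rewrite -(fineK (integrable_fin_num _ iF))//; exact: fine_cvg.
exists x; split => //.
- rewrite flowx//; apply/colP => i; rewrite mxE set_itv1 Rintegral_set1 addr0 //.
- move=> t t0 i; split; first exact: int_F.
  by rewrite {1}flowx// mxE.
Qed.

End caratheodory.

(** * Concave differentiable functions *)

Section differentiable_functions.
Variables (R : realType) (n : nat) (r : 'cV[R]_n -> R).

Lemma diff_gradE x v : differentiable r x ->
  'd r x v = \sum_i grad r x i 0 * v i 0.
Proof.
move=> dr; rewrite {1}(matrix_sum_delta v) linear_sum/=; apply: eq_bigr => i _.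
by rewrite big_ord1 linearZ/= mxE deriveE// mulrC.
Qed.

Lemma diff_expansion x : differentiable r x -> forall e, 0 < e ->
  \forall d \near (0 : 'cV[R]_n), `|r (d + x) - r x - 'd r x d| <= e * `|d|.
Proof.
move=> dr e e0; have kE := diff_locallyx dr.
set k := 'o _ in kE.
have H := littleoP [littleo of k] e0.
near=> d; rewrite [X in `|X|](_ : _ = k d); first by near: d.
by rewrite kE; ring.
Unshelve. all: by end_near. Qed.

Lemma continuous_le_compact (A : set 'cV[R]_n) : continuous r -> compact A ->
  exists M, forall x, A x -> r x <= M.
Proof.
move=> cr cA; have [[a Aa]|/set0P/negP/negPn/eqP ->] := pselect (A !=set0); last by exists 0.
have [||//|c _ H] := @compact_EVT_max _ _ r A; [by exists a|by []|exact: continuous_subspaceT|].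
by exists (r c) => x Ax; apply: H; rewrite inE.
Qed.

Lemma continuous_gt0_compact (A : set 'cV[R]_n) : continuous r -> compact A ->
  (forall x, A x -> 0 < r x) -> exists2 q, 0 < q & forall x, A x -> q <= r x.
Proof.
move=> cr cA r0; have [[a Aa]|/set0P/negP/negPn/eqP ->] := pselect (A !=set0); last by exists 1.
have [||//|c /set_mem Ac H] := @compact_EVT_min _ _ r A; [by exists a|by []|exact: continuous_subspaceT|].
by exists (r c); [exact: r0|move=> x Ax; apply: H; rewrite inE].
Qed.

End differentiable_functions.

Section concave_functions.
Variables (R : realType) (n : nat) (r : 'cV[R]_n -> R).
Hypothesis r_diff : forall x, differentiable r x.
Hypothesis r_concave : forall x y t, 0 <= t <= 1 ->
  t * r x + (1 - t) * r y <= r (t *: x + (1 - t) *: y).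

(** By concavity the difference quotients of [r] at [x] towards [y] are at least [r y - r x], and
    they tend to the directional derivative. *)
Lemma supergradient x y : r y - r x <= 'd r x (y - x).
Proof.
apply/ler_addgt0Pr => e e0; set v := y - x.
have v1 : 0 < `|v| + 1 by rewrite ltr_wpDl.
have := diff_expansion (r_diff x) (divr_gt0 e0 v1).
case/nbhs_ballP => d /= d0 dP.
(* The step keeps [h *: v] in the ball where the expansion holds with error
   [e / (|v| + 1) * |h *: v|], which is at most [h * e]. *)
pose h := Num.min 1 (d / 2 / (`|v| + 1)).
have h0 : 0 < h by rewrite lt_min ltr01/= !divr_gt0.
have h1 : h <= 1 by rewrite ge_min lexx.
have hv : `|h *: v| < d.
  rewrite normrZ gtr0_norm// (@le_lt_trans _ _ (d / 2))//; last by lra.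
  rewrite (@le_trans _ _ (h * (`|v| + 1)))//.
    by rewrite ler_wpM2l ?ltW// ltrDl.
  by rewrite -ler_pdivlMr// ge_min lexx orbT.
have /dP : ball (0 : 'cV[R]_n) d (h *: v) by rewrite -ball_normE/= sub0r normrN.
rewrite /= linearZ/= normrZ (gtr0_norm h0) => /ler_normlP[_ H].
have := r_concave y x; move=> /(_ h); rewrite (ltW h0) h1 => /(_ isT).
rewrite (_ : h *: y + (1 - h) *: x = h *: v + x); last first.
  by rewrite /v scalerBr scalerBl scale1r -addrA [- _ + x]addrC.
move=> H2; rewrite -(ler_pM2l h0).
have H3 : e / (`|v| + 1) * (h * `|v|) <= h * e.
  rewrite mulrCA ler_pM2l// mulrAC ler_pdivrMr// ler_pM2l//; lra.
move: H H2 H3; rewrite -[_ *: 'd r x v]/(h * 'd r x v); lra.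
Qed.

Lemma concave_continuous : continuous r.
Proof. by move=> x; apply: differentiable_continuous. Qed.

(** The supergradient inequality in the directions [h *: v] and [- h *: v] squeezes a partial
    derivative at [y] between two difference quotients at [y]. For fixed [h] these tend to the
    quotients at [x], which are close to the partial derivative at [x] when [h] is small. *)
Lemma grad_continuous : continuous (grad r).
Proof.
move=> x; apply: (@cvg_mx R _ (nbhs x) _ n 1 (grad r)) => i j; rewrite ord1.
apply/cvgrPdist_le => e e0.
have dE y w : 'd r y (w *: delta_mx i 0) = w * grad r y i 0.
  by rewrite linearZ/= mxE deriveE.
pose v : 'cV[R]_n := delta_mx i 0.
have v1 : `|v| <= 1.
  by apply: normr_mx_le => // k l; rewrite mxE; case: (_ && _); rewrite ?normr1 ?normr0.
(* Error budget: [e / 4] for the expansion at [x], and [e / 8] for each of the two values of [r]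
   moved from [x] to [y]. *)
have e4 : 0 < e / 4 by lra.
have /nbhs_ballP[d /= d0 dP] := diff_expansion (r_diff x) e4.
pose h := d / 2.
have h0 : 0 < h by rewrite divr_gt0.
have hd w : `|w| = h -> `|r (w *: v + x) - r x - w * grad r x i 0| <= e / 4 * h.
  move=> wh; have /dP : ball (0 : 'cV[R]_n) d (w *: v).
    rewrite -ball_normE/= sub0r normrN normrZ wh (@le_lt_trans _ _ h)//.
      by rewrite ler_piMr// ltW.
    by rewrite /h; lra.
  rewrite /= dE normrZ wh => /le_trans; apply; rewrite ler_pM2l// ler_piMr//.
  exact: ltW.
have := hd (- h); rewrite normrN gtr0_norm// => /(_ erefl) hN.
have := hd h; rewrite gtr0_norm// => /(_ erefl) hP.
have rc w : \forall y \near x, `|r (w *: v + x) - r (w *: v + y)| <= e / 8 * h.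
  have : r (w *: v + y) @[y --> x] --> r (w *: v + x).
    have wx : w *: v + y @[y --> x] --> w *: v + x.
      by apply: (@cvgD R _ _ (nbhs x)); [exact: cvg_cst|exact: cvg_id].
    exact: (cvg_comp _ _ wx (@concave_continuous _)).
  by move=> /cvgrPdist_le; apply; rewrite mulr_gt0// divr_gt0.
near=> y.
have y0 : `|r (0 *: v + x) - r (0 *: v + y)| <= e / 8 * h by near: y; exact: rc.
have yh : `|r (h *: v + x) - r (h *: v + y)| <= e / 8 * h by near: y; exact: rc.
have yN : `|r (- h *: v + x) - r (- h *: v + y)| <= e / 8 * h by near: y; exact: rc.
have := supergradient y (h *: v + y); have := supergradient y (- h *: v + y).
rewrite !addrK !dE.
move: hP hN y0 yh yN; rewrite scale0r !add0r.
rewrite !ler_norml => /andP[? ?] /andP[? ?] /andP[? ?] /andP[? ?] /andP[? ?] ? ?.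
by apply/andP; split; rewrite -(ler_pM2l h0); nra.
Unshelve. all: by end_near. Qed.

(** By the supergradient inequality a critical point is a global maximum. *)
Lemma grad_neq0 x y : r x < r y -> grad r x != 0.
Proof.
move=> xy; apply/eqP => g0; have := supergradient x y.
rewrite diff_gradE// big1 => [|i _]; last by rewrite g0 mxE mul0r.
by rewrite leNgt subr_gt0 xy.
Qed.

(** If [c <= r x], then a convex combination of [x] and [y] with a small weight [s] on [x],
    depending only on [c], has positive robustness. It is therefore bounded by [C], which bounds
    [s *: x]. *)
Lemma superlevel_bounded y C : 0 < r y -> (forall x, 0 < r x -> `|x| <= C) ->
  forall c, exists M, forall x, c <= r x -> `|x| <= M.
Proof.
move=> ry rC c; pose a := r y; pose k := a + `|c|.
have k0 : 0 < k by rewrite ltr_pwDl.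
(* Concavity bounds [r] at the combination below by [a - s * k], which this choice makes equal to
   [a / 2]. *)
pose s := a / (2 * k).
have s0 : 0 < s by rewrite divr_gt0// mulr_gt0.
have sk : s * k = a / 2 by rewrite /s; field; rewrite gt_eqF.
have s1 : s <= 1.
  rewrite ler_pdivrMr ?mulr_gt0// mul1r /k; have := normr_ge0 c.
  by rewrite /a in ry *; move: ry; lra.
exists ((C + `|(1 - s) *: y|) / s) => x cx.
rewrite ler_pdivlMr// (_ : `|x| * s = `|s *: x|); last first.
  by rewrite normrZ (gtr0_norm s0) mulrC.
rewrite -[s *: x](addrK ((1 - s) *: y)); apply: le_trans (ler_normB _ _) _.
rewrite lerD2r; apply: rC.
have := r_concave x y (t := s); rewrite (ltW s0) s1 => /(_ isT); apply: lt_le_trans.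
have : s * r x >= s * - `|c|.
  rewrite ler_wpM2l ?(ltW s0)//; apply: le_trans cx.
  by rewrite lerNl -normrN ler_norm.
rewrite -/a; rewrite -/a in ry; rewrite /k in sk; nra.
Qed.

Lemma superlevel_compact y C : 0 < r y -> (forall x, 0 < r x -> `|x| <= C) ->
  forall c, compact [set x | c <= r x].
Proof.
move=> ry rC c; apply: compact_cV.
  have [M HM] := superlevel_bounded ry rC c.
  exists M; split; first exact: num_real.
  by move=> N MN x /HM; move/le_trans; apply; exact: ltW.
apply: (preimage_closed (D := [set z | c <= z])); last exact: closed_ge.
by move=> x _; exact: concave_continuous.
Qed.

End concave_functions.

(** * Paths and the logit function *)

(** The supremum of the times up to which [P] holds satisfies [P] by the second hypothesis; the
    third would push it further if it lay before [t]. *)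
Lemma real_induction (R : realType) (P : R -> Prop) : P 0 ->
  (forall t, 0 < t -> (forall s, 0 <= s < t -> P s) -> P t) ->
  (forall t, 0 <= t -> P t -> exists2 d, 0 < d & forall s, t <= s < t + d -> P s) ->
  forall t, 0 <= t -> P t.
Proof.
move=> P0 Pl Pr t t0; pose S := [set s | 0 <= s <= t /\ forall u, 0 <= u <= s -> P u].
have S0 : S 0.
  by split=> [|u /andP[u0 u1]]; [rewrite lexx|rewrite (_ : u = 0)//; apply/le_anti/andP].
have Sub : has_ubound S by exists t => s [/andP[]].
have St c : S c -> c <= sup S by exact: ub_le_sup.
have supt : sup S <= t by apply: ge_sup; [exists 0|move=> s [/andP[]]].
have sup0 : 0 <= sup S by exact: St.
have Plt u : 0 <= u < sup S -> P u.
  move=> /andP[u0 uS]; have [||s [_ sP] us] := @sup_adherent _ S (sup S - u).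
  - by rewrite subr_gt0.
  - by split; [exists 0|].
  - by apply: sP; rewrite u0/= ltW//; move: us; rewrite opprB addrCA subrr addr0.
have Psup : P (sup S).
  by move: sup0; rewrite le_eqVlt => /predU1P[<-//|sup1]; exact: Pl.
have [d d0 Pd] := Pr _ sup0 Psup.
have Ple u : 0 <= u < sup S + d -> P u.
  move=> /andP[u0 ud]; have [uS|Su] := ltP u (sup S); first by apply: Plt; rewrite u0.
  by apply: Pd; rewrite Su.
have [tS|St'] := ltP t (sup S + d); first by apply: Ple; rewrite t0.
have : S (sup S + d / 2).
  split; first by apply/andP; split; [rewrite addr_ge0// divr_ge0// ltW|lra].
  by move=> u /andP[u0 us]; apply: Ple; rewrite u0/=; lra.
by move=> /St; rewrite gerDl; lra.
Qed.

Lemma near_withinP (R : realType) (A P : set R) (t : R) :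
  (\forall s \near within A (nbhs t), P s) ->
  exists2 d, 0 < d & forall s, A s -> `|s - t| < d -> P s.
Proof.
move=> /nbhs_ballP[d /= d0 dP]; exists d => // s As st; apply: dP => //.
by rewrite -ball_normE/= distrC.
Qed.

Lemma Rintegral_linear_combination (R : realType) (I : Type) (p : seq I)
    (a : I -> R) (V : I -> R -> R) (D : set R) : measurable D ->
  (forall i, (@lebesgue_measure R).-integrable D (fun s => (V i s)%:E)) ->
  (@lebesgue_measure R).-integrable D (fun s => (\sum_(i <- p) a i * V i s)%:E) /\
  \int[@lebesgue_measure R]_(s in D) (\sum_(i <- p) a i * V i s) =
  \sum_(i <- p) a i * \int[@lebesgue_measure R]_(s in D) V i s.
Proof.
move=> mD iV; elim: p => [|i p [iS eS]].
  split; first by under eq_fun do rewrite big_nil; exact: integrable0.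
  by under eq_Rintegral do rewrite big_nil; rewrite big_nil Rintegral_cst// mul0r.
have iai : (@lebesgue_measure R).-integrable D (fun s => (a i * V i s)%:E).
  by under eq_fun do rewrite EFinM; exact: integrableZl.
split.
  by under eq_fun do rewrite big_cons EFinD; exact: integrableD.
rewrite big_cons -eS -(@RintegralZl _ _ _ (@lebesgue_measure R) D (V i) (a i) mD (iV i)).
rewrite -(@RintegralD _ _ _ (@lebesgue_measure R) D (fun s => a i * V i s) _ mD iai iS).
by apply: eq_Rintegral => s _; rewrite big_cons.
Qed.

(* Replaces the chain rule along a path that is only absolutely continuous. *)
Lemma path_increment (R : realType) (n : nat) (r : 'cV[R]_n -> R)
    (x V : R -> 'cV[R]_n) (t1 d1 M c c' sg : R) :
  differentiable r (x t1) -> `|sg| <= 1 -> 0 < d1 ->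
  (forall t, t1 <= t < t1 + d1 -> forall i,
     (@lebesgue_measure R).-integrable `[t1, t] (fun s => (V s i 0)%:E) /\
     x t i 0 - x t1 i 0 = \int[@lebesgue_measure R]_(s in `[t1, t]) V s i 0) ->
  (forall s, t1 <= s < t1 + d1 -> `|V s| <= M) ->
  (forall s, t1 <= s < t1 + d1 ->
     \sum_i (sg * grad r (x t1) i 0) * V s i 0 <= c) ->
  c < c' ->
  exists2 d, 0 < d & forall t, t1 <= t < t1 + d ->
    sg * (r (x t) - r (x t1)) <= c' * (t - t1).
Proof.
move=> dr sg1 d10 xV VM Vc cc'.
have M0 : 0 <= M by apply: le_trans (VM t1 _) => //; rewrite lexx ltrDl.
have M1 : 0 < M + 1 by rewrite ltr_wpDl.
(* As the path moves by at most [M * (t - t1)], this accuracy makes the remainder at most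
   [(c' - c) * (t - t1)]. *)
have /nbhs_ballP[d2 /= d20 d2P] := diff_expansion dr (divr_gt0 (eqbRL (subr_gt0 _ _) cc') M1).
have d3 : 0 < d2 / (M + 1) by rewrite divr_gt0.
exists (Num.min d1 (d2 / (M + 1))); first by rewrite lt_min d10.
move=> t /andP[t1t]; rewrite -ltrBlDl lt_min => /andP[td1 td2].
have tt : t1 <= t < t1 + d1 by rewrite t1t -ltrBlDl.
have t10 : 0 <= t - t1 by rewrite subr_ge0.
have iV i : (@lebesgue_measure R).-integrable `[t1, t] (fun s => (V s i 0)%:E).
  by have [] := xV _ tt i.
have xE i : x t i 0 - x t1 i 0 = \int[@lebesgue_measure R]_(s in `[t1, t]) V s i 0.
  by have [] := xV _ tt i.
have dx : `|x t - x t1| <= M * (t - t1).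
  apply: normr_mx_le => [|i j]; first by rewrite mulr_ge0.
  rewrite ord1 !mxE xE; apply: le_trans (le_normr_Rintegral _ (iV i)) _ => //.
  apply: Rintegral_le => //.
    by have := integrable_norm (iV i).
  move=> s /andP[s1 s2]; apply: le_trans (normr_entry_le _ _ _) _.
  by apply: VM; rewrite s1 (le_lt_trans s2)// -ltrBlDl.
have xd2 : `|x t - x t1| < d2.
  apply: le_lt_trans dx _; apply: (@le_lt_trans _ _ ((M + 1) * (t - t1))).
    by rewrite ler_wpM2r// lerDl.
  by rewrite mulrC -ltr_pdivlMr.
have := d2P (x t - x t1); rewrite -ball_normE/= sub0r normrN => /(_ xd2).
rewrite subrK diff_gradE//.
set S := \sum_i _ => H.
(* The gradient is frozen at [x t1], so the linear term is the integral of one scalar function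
   bounded by [c]. *)
have SE : sg * S <= c * (t - t1).
  have [iL eL] := @Rintegral_linear_combination R _ (index_enum 'I_n)
    (fun i => sg * grad r (x t1) i 0) (fun i s => V s i 0) `[t1, t]%classic
    (measurable_itv _) iV.
  rewrite (_ : sg * S = \int[@lebesgue_measure R]_(s in `[t1, t])
    (\sum_i (sg * grad r (x t1) i 0) * V s i 0)).
    by apply: Rintegral_le => // s /andP[s1 s2]; apply: Vc;
      rewrite s1 (le_lt_trans s2)// -ltrBlDl.
  rewrite eL mulr_sumr; apply: eq_bigr => i _.
  by rewrite -mulrA !mxE -xE.
rewrite (_ : r _ - _ = S + (r (x t) - r (x t1) - S)); last by ring.
rewrite mulrDr; apply: (@le_trans _ _ (c * (t - t1) + (c' - c) * (t - t1))).
  2: by rewrite -mulrDl addrCA subrr addr0.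
rewrite lerD//; apply: le_trans (ler_norm _) _; rewrite normrM.
apply: le_trans (ler_piMl _ sg1) _ => //; apply: le_trans H _.
apply: (@le_trans _ _ ((c' - c) / (M + 1) * ((M + 1) * (t - t1)))).
  rewrite ler_wpM2l//; first by rewrite ltW// divr_gt0// subr_gt0.
  by apply: le_trans dx _; rewrite ler_wpM2r// lerDl.
by rewrite mulrA divfK// gt_eqF.
Qed.

Section logit.
Variable R : realType.
Implicit Types (z a M : R).

(* [epsilon] is [logit] of [xi]. *)
Definition logit z : R := ln (- ((z + 1) / z)).

Lemma logit_arg_gt0 z : -1 < z < 0 -> 0 < - ((z + 1) / z).
Proof.
move=> /andP[z1 z0]; rewrite -mulrN -invrN divr_gt0 ?oppr_gt0//.
by rewrite -ltrBlDr sub0r.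
Qed.

Lemma cvg_logit (T : Type) (F : set_system T) (FF : Filter F) (u : T -> R) z :
  -1 < z < 0 -> u t @[t --> F] --> z -> logit (u t) @[t --> F] --> logit z.
Proof.
move=> z01 uz; have /andP[_ z0] := z01.
have H : - ((u t + 1) / u t) @[t --> F] --> - ((z + 1) / z).
  apply: cvgN; apply: cvgM; first by apply: cvgD => //; exact: cvg_cst.
  by apply: cvgV => //; rewrite lt_eqF.
exact: (cvg_comp _ _ H (@continuous_ln _ _ (logit_arg_gt0 z01))).
Qed.

(** Reflection about -1/2 inverts the argument of the logarithm, so one margin serves both walls of
    the funnel. *)
Lemma logitN a : 0 < a < 1 -> logit (- 1 + a) = - logit (- a).
Proof.
move=> /andP[a0 a1]; rewrite /logit -lnV; last first.
  by rewrite posrE logit_arg_gt0// ltrN2 oppr_lt0 a0 a1.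
by congr ln; field; do ?[apply/andP; split]; apply/eqP => ?; lra.
Qed.

(** The argument of the logarithm is [- 1 - 1 / z], increasing on negative [z]. *)
Lemma logit_le y z : -1 < y -> y <= z -> z < 0 -> logit y <= logit z.
Proof.
move=> y1 yz z0; have y0 := le_lt_trans yz z0; have z1 := lt_le_trans y1 yz.
rewrite ler_ln ?posrE ?logit_arg_gt0 ?y1 ?z1// lerN2.
by rewrite !mulrDl !mul1r !divff ?lt_eqF// lerD2l lef_nV2.
Qed.

Lemma logit_bound a z : 0 < a < 1 -> - 1 + a <= z <= - a ->
  `|logit z| <= logit (- a).
Proof.
move=> a01 /andP[az za]; have /andP[a0 a1] := a01.
rewrite ler_norml -logitN// !logit_le//; lra.
Qed.

Lemma logit_margin M z : 0 < M -> -1 < z < 0 ->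
  exists a, [/\ 0 < a < 1 / 2, - 1 + a <= z <= - a & M <= logit (- a)].
Proof.
move=> M0 /andP[z1 z0]; have eM : 1 < expR M by rewrite expR_gt1.
(* This [b] solves [logit (- b) = M] and is below 1/2 because [M] is positive. Shrinking it to the
   distances from [z] to -1 and 0 only increases the logit. *)
pose b := (1 + expR M)^-1; have e1 : 0 < 1 + expR M by lra.
have b0 : 0 < b by rewrite invr_gt0.
have b1 : b < 1 / 2 by rewrite /b invf_plt ?posrE//; lra.
exists (Num.min b (Num.min (- z) (1 + z))).
set a := Num.min _ _.
have ab : a <= b by rewrite ge_min lexx.
have az : a <= - z by rewrite /a !ge_min lexx orbT.
have az1 : a <= 1 + z by rewrite /a !ge_min lexx !orbT.
have a0 : 0 < a by rewrite !lt_min b0/=; apply/andP; split; lra.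
split; [by rewrite a0; lra|by apply/andP; split; lra|].
apply: (@le_trans _ _ (logit (- b))); last by apply: logit_le; lra.
rewrite /logit (_ : - _ = expR M) ?expRK// /b; field.
by apply/eqP => ?; lra.
Qed.

End logit.

(** * Invariance of the funnel *)

Lemma sum_mulmx (R : realType) n (p v : 'cV[R]_n) :
  \sum_i p i 0 * v i 0 = (p^T *m v) 0 0.
Proof. by rewrite mxE; apply: eq_bigr => i _; rewrite mxE. Qed.

Section funnel.
Variables (R : realType) (gamma0 gammaoo l : R).
Hypotheses (gammaoo_gt0 : 0 < gammaoo) (gammaoo_le : gammaoo <= gamma0).
Hypothesis l_ge0 : 0 <= l.
Notation gam := (gamma gamma0 gammaoo l).

Lemma gamma_gt0 t : 0 < gam t.
Proof. by rewrite ltr_wpDl// mulr_ge0 ?subr_ge0// expR_ge0. Qed.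

Lemma gamma_at0 : gam 0 = gamma0.
Proof. by rewrite /gamma mulr0 expR0 mulr1 subrK. Qed.

Lemma gamma_nonincreasing s t : s <= t -> gam t <= gam s.
Proof.
move=> st; rewrite lerD2r ler_wpM2l ?subr_ge0// ler_expR !mulNr lerN2.
by rewrite ler_wpM2l.
Qed.

Lemma gamma_le_gamma0 t : 0 <= t -> gam t <= gamma0.
Proof. by move=> /gamma_nonincreasing; rewrite gamma_at0. Qed.

(** From [1 - exp (- y) <= y]: the funnel contracts at rate at most [l * (gamma0 - gammaoo)]. *)
Lemma gamma_lipschitz s t : 0 <= s -> s <= t ->
  gam s - gam t <= l * (gamma0 - gammaoo) * (t - s).
Proof.
move=> s0 st; rewrite /gamma opprD addrACA subrr addr0 -mulrBr.
rewrite [X in _ <= X](_ : _ = (gamma0 - gammaoo) * (l * (t - s))); last by ring.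
rewrite ler_wpM2l ?subr_ge0//.
rewrite [X in _ - expR X](_ : _ = - l * s + - (l * (t - s))); last by ring.
rewrite expRD -{1}[expR (- l * s)]mulr1 -mulrBr.
have H : 1 - expR (- (l * (t - s))) <= l * (t - s).
  by have := expR_ge1Dx (- (l * (t - s))); lra.
apply: (@le_trans _ _ (expR (- l * s) * (l * (t - s)))).
  by rewrite ler_wpM2l// expR_ge0.
rewrite ler_piMl ?mulr_ge0 ?subr_ge0// -expR0 ler_expR mulNr oppr_le0.
by rewrite mulr_ge0.
Qed.

Lemma cvg_gamma (T : Type) (F : set_system T) (FF : Filter F) (u : T -> R) t :
  u s @[s --> F] --> t -> gam (u s) @[s --> F] --> gam t.
Proof.
move=> ut; apply: cvgD; last exact: cvg_cst.
apply: cvgM; first exact: cvg_cst.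
have H : - l * u s @[s --> F] --> - l * t by apply: cvgM => //; exact: cvg_cst.
exact: (cvg_comp _ _ H (@continuous_expR _ _)).
Qed.

(** * Barrier argument for the closed loop *)

Section closed_loop.
Variables (n m : nat) (f : 'cV[R]_n -> 'cV[R]_n) (g : 'cV[R]_n -> 'M[R]_(n, m)).
Variables (psi : formula R n) (rho_max Wb : R) (w : R -> 'cV[R]_n).
Notation r := (rho_fin psi).
Notation XI := (xi psi rho_max gamma0 gammaoo l).
Hypotheses (f_continuous : continuous f) (g_continuous : continuous g).
Hypothesis r_diff : forall x, differentiable r x.
Hypothesis r_concave : forall x y t, 0 <= t <= 1 ->
  t * r x + (1 - t) * r y <= r (t *: x + (1 - t) *: y).
Hypothesis w_bounded : forall s, 0 <= s -> `|w s| <= Wb.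

(** The noise-free closed-loop field, with the value of [epsilon] as a free parameter so that it can
    be clamped later. *)
Definition drift (e : R) (x : 'cV[R]_n) : 'cV[R]_n :=
  f x + g x *m (- e *: ((g x)^T *m grad r x)).

(** The squared Euclidean norm of [g^T grad r], as a quadratic form in [g g^T] so that positive
    definiteness applies directly. *)
Definition control_gain (x : 'cV[R]_n) : R :=
  ((grad r x)^T *m (g x *m (g x)^T) *m grad r x) 0 0.

(** Bounds the absolute value of the pairing of [grad r x] with [f x + v] for every [v] of norm at
    most [Wb]. *)
Definition disturbance_bound (x : 'cV[R]_n) : R :=
  \sum_i `|grad r x i 0| * (`|f x i 0| + Wb).

Lemma grad_drift e x : \sum_i grad r x i 0 * drift e x i 0 =
  \sum_i grad r x i 0 * f x i 0 - e * control_gain x.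
Proof.
rewrite !sum_mulmx /drift mulmxDr mxE -scalemxAr -scalemxAr.
rewrite /control_gain -!mulmxA mulmxA -!mulmxA.
by rewrite [X in _ + X]mxE mulNr.
Qed.

Lemma cvg_drift (T : Type) (F : set_system T) (FF : Filter F) (u : T -> R)
    (y : T -> 'cV[R]_n) e x :
  u s @[s --> F] --> e -> y s @[s --> F] --> x ->
  drift (u s) (y s) @[s --> F] --> drift e x.
Proof.
move=> ue yx.
have fy : f (y s) @[s --> F] --> f x := cvg_comp _ _ yx (@f_continuous _).
have gy : g (y s) @[s --> F] --> g x := cvg_comp _ _ yx (@g_continuous _).
have Gy : grad r (y s) @[s --> F] --> grad r x :=
  cvg_comp _ _ yx (@grad_continuous _ _ _ r_diff r_concave _).
apply: cvgD => //; apply: cvg_mulmx => //; apply: cvgZ; first exact: cvgN.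
by apply: cvg_mulmx => //; exact: cvg_trmx.
Qed.

Lemma cvg_xi (T : Type) (F : set_system T) (FF : Filter F) (u : T -> R)
    (y : T -> 'cV[R]_n) t x :
  u s @[s --> F] --> t -> y s @[s --> F] --> x ->
  XI (y s) (u s) @[s --> F] --> XI x t.
Proof.
move=> ut yx; apply: cvgM; last first.
  by apply: cvgV; [rewrite gt_eqF// gamma_gt0|exact: cvg_gamma].
apply: cvgD; last exact: cvg_cst.
exact: (cvg_comp _ _ yx (@concave_continuous _ _ _ r_diff x)).
Qed.

(* Near the boundary of the funnel the control term dominates the drift, the
   noise and the contraction rate of the funnel. *)
Lemma barrier_step (x V : R -> 'cV[R]_n) (t1 d0 sg : R) :
  0 <= t1 -> 0 < d0 -> `|sg| = 1 -> -1 < XI (x t1) t1 < 0 ->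
  x s @[s --> within (`[t1, t1 + d0[)%classic (nbhs t1)] --> x t1 ->
  (forall t, t1 <= t < t1 + d0 -> forall i,
     (@lebesgue_measure R).-integrable `[t1, t] (fun s => (V s i 0)%:E) /\
     x t i 0 - x t1 i 0 = \int[@lebesgue_measure R]_(s in `[t1, t]) V s i 0) ->
  (forall s, t1 <= s < t1 + d0 -> V s = drift (logit (XI (x s) s)) (x s) + w s) ->
  disturbance_bound (x t1) + l * (gamma0 - gammaoo) <
    sg * logit (XI (x t1) t1) * control_gain (x t1) ->
  exists2 d, 0 < d & forall t, t1 <= t < t1 + d ->
    sg * (r (x t) - r (x t1)) <= - (l * (gamma0 - gammaoo)) * (t - t1).
Proof.
move=> t10 d00 sg1 xi1 xc xV VE gain.
set D := within _ _ in xc.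
have tc : s @[s --> D] --> t1 by apply: cvg_within.
have bc : drift (logit (XI (x s) s)) (x s) @[s --> D] -->
    drift (logit (XI (x t1) t1)) (x t1).
  by apply: cvg_drift => //; apply: cvg_logit => //; exact: cvg_xi.
pose b s := drift (logit (XI (x s) s)) (x s).
pose p := grad r (x t1).
(* Bounds [sg] times the gradient frozen at [x t1] paired with [V s]. The noise enters only through
   [Wb], so [P] has a limit at [t1] without any continuity of [w]. *)
pose P s := sg * (\sum_i p i 0 * b s i 0) + \sum_i `|p i 0| * Wb.
have Pc : P s @[s --> D] --> P t1.
  apply: cvgD; last exact: cvg_cst.
  apply: cvgM; first exact: cvg_cst.
  apply: cvg_big => [|i _]; first by move=> u; exact: add_continuous.
  by apply: cvgM; [exact: cvg_cst|exact: cvg_entry].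
have Pt1 : P t1 < - (l * (gamma0 - gammaoo)).
  rewrite /P grad_drift.
  have : sg * (\sum_i p i 0 * f (x t1) i 0) + \sum_i `|p i 0| * Wb <=
      disturbance_bound (x t1).
    rewrite /disturbance_bound mulr_sumr -big_split/=; apply: ler_sum => i _.
    rewrite mulrDr lerD2r; apply: le_trans (ler_norm _) _.
    by rewrite !normrM sg1 mul1r.
  move: gain; rewrite -/p; set S1 := \sum_i p i 0 * _; set S2 := \sum_i `|_| * _.
  by move=> ? ?; lra.
(* The midpoint between [P t1] and the required rate, leaving room on both sides. *)
pose c := (P t1 - l * (gamma0 - gammaoo)) / 2.
have Pc' : \forall s \near D, P s < c.
  by apply: (cvgr_lt (P t1)) => //; rewrite /c; lra.
have bb : \forall s \near D, `|b s| < `|b t1| + 1.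
  by apply: (cvgr_lt `|b t1|); [exact: cvg_norm|rewrite ltrDl].
have [d1 d10 Pd1] := near_withinP Pc'.
have [d2 d20 bd2] := near_withinP bb.
pose d := Num.min d0 (Num.min d1 d2).
have dd0 : d <= d0 by rewrite ge_min lexx.
have dd1 : d <= d1 by rewrite !ge_min lexx orbT.
have dd2 : d <= d2 by rewrite !ge_min lexx !orbT.
have inA s : t1 <= s < t1 + d -> [/\ t1 <= s < t1 + d0, s \in `[t1, t1 + d0[,
    `|s - t1| < d1 & `|s - t1| < d2].
  move=> /andP[s1 s2].
  have -> : `|s - t1| = s - t1 by rewrite ger0_norm ?subr_ge0.
  by rewrite in_itv/= s1/=; split; lra.
apply: (@path_increment _ _ r x V t1 d (`|b t1| + 1 + Wb) c) => //.
- by rewrite sg1.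
- by rewrite !lt_min d00 d10.
- by move=> t /inA[td _ _ _]; exact: xV.
- move=> s /[dup] /andP[s1 _] /inA[sd sA _ s2]; rewrite VE//.
  apply: le_trans (ler_normD _ _) _; rewrite lerD//; first exact/ltW/bd2.
  by apply: w_bounded; exact: le_trans s1.
- move=> s /[dup] /andP[s1 _] /inA[sd sA s2 _]; rewrite VE//.
  apply: le_trans (ltW (Pd1 s sA s2)).
  rewrite /P mulr_sumr -big_split/=; apply: ler_sum => i _.
  rewrite [X in _ * X <= _]mxE mulrDr mulrA lerD2l; apply: le_trans (ler_norm _) _.
  rewrite !normrM sg1 mul1r ler_wpM2l//.
  apply: le_trans (normr_entry_le _ _ _) (w_bounded _); exact: le_trans s1.
- by rewrite /c; lra.
Qed.

(** As [gamma] never exceeds [gamma0], the funnel at every time lies in the fixed set on which the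
    margin [eta] is chosen. *)
Lemma xi_in_funnel x t : 0 <= t -> -1 < XI x t < 0 ->
  rho_max - gamma0 <= r x <= rho_max.
Proof.
move=> t0; rewrite ltr_pdivlMr ?gamma_gt0// ltr_pdivrMr ?gamma_gt0// mul0r mulN1r.
by have := gamma_le_gamma0 t0; move=> ? /andP[? ?]; apply/andP; split; lra.
Qed.

(* V is required to be the closed-loop field inside a slightly larger funnel only,
   so that the lemma also applies to the truncated field. *)
Lemma funnel_invariant (T eta : R) (x0 : 'cV[R]_n) (x V : R -> 'cV[R]_n) :
  0 < eta < 1 / 2 -> - 1 + eta <= XI x0 0 <= - eta ->
  (forall y, rho_max - gamma0 <= r y <= rho_max ->
     disturbance_bound y + l * (gamma0 - gammaoo) <
     logit (- eta) * control_gain y) ->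
  x 0 = x0 -> {within `[0, T[, continuous x} ->
  (forall t, 0 <= t < T -> forall i,
     (@lebesgue_measure R).-integrable `[0, t] (fun s => (V s i 0)%:E) /\
     x t i 0 = x0 i 0 + \int[@lebesgue_measure R]_(s in `[0, t]) V s i 0) ->
  (forall s, 0 <= s < T -> - 1 + eta / 2 < XI (x s) s < - (eta / 2) ->
     V s = drift (logit (XI (x s) s)) (x s) + w s) ->
  forall t, 0 <= t < T -> - 1 + eta <= XI (x t) t <= - eta.
Proof.
move=> /andP[eta0 eta1] xi0 gain x00 /subspace_continuousP xc xV VE.
suff H : forall t, 0 <= t -> t < T -> - 1 + eta <= XI (x t) t <= - eta.
  by move=> t /andP[t0 tT]; exact: H.
have xic t : 0 <= t < T ->
    XI (x s) s @[s --> within (`[0, T[)%classic (nbhs t)] --> XI (x t) t.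
  move=> tT; apply: cvg_xi; first by apply: cvg_within.
  by apply: xc; rewrite /= in_itv/=.
apply: real_induction => [_|t t0 IH tT|t1 t10 + ]; first by rewrite x00.
  have tT' : 0 <= t < T by rewrite ltW.
  (* The closed bounds pass to [t] from earlier times: a strict violation at [t] would by continuity
     already occur slightly before. *)
  have before d : 0 < d -> exists s, [/\ 0 <= s < t, s \in `[0, T[ & `|s - t| < d].
    move=> d0; exists (Num.max 0 (t - d / 2)); set s := Num.max _ _.
    have s0 : 0 <= s by rewrite le_max lexx.
    have s1 : t - d / 2 <= s by rewrite le_max lexx orbT.
    have st : s < t by rewrite gt_max t0/=; lra.
    rewrite in_itv/= s0 st ltr_norml; split; [by []|lra|lra].
  apply/andP; split; rewrite leNgt; apply/negP => xit.
    have [d d0 dP] := near_withinP (cvgr_lt (XI (x t) t) (xic _ tT') _ xit).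
    have [s [/[dup] /andP[_ st] /IH sI sT sd]] := before _ d0.
    have /andP[+ _] := sI (lt_trans st tT).
    by rewrite leNgt (dP _ sT sd).
  have [d d0 dP] := near_withinP (cvgr_gt (XI (x t) t) (xic _ tT') _ xit).
  have [s [/[dup] /andP[_ st] /IH sI sT sd]] := before _ d0.
  have /andP[_] := sI (lt_trans st tT).
  by rewrite leNgt (dP _ sT sd).
have [Tt1 _|t1T /(_ isT) /andP[lo hi]] := leP T t1.
  by exists 1 => // s /andP[s1 _] sT; move: (le_lt_trans (le_trans Tt1 s1) sT); rewrite ltxx.
have t1T' : 0 <= t1 < T by rewrite t10.
(* Near [t1] the path stays in the larger funnel, where [V] is known to be the closed-loop field. *)
have [d1 d10 d1P] : exists2 d, 0 < d & forall s, s \in `[0, T[ -> `|s - t1| < d ->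
    - 1 + eta / 2 < XI (x s) s < - (eta / 2).
  have [a a0 aP] := near_withinP (cvgr_lt (XI (x t1) t1) (xic _ t1T')
    (- (eta / 2)) ltac:(lra)).
  have [b b0 bP] := near_withinP (cvgr_gt (XI (x t1) t1) (xic _ t1T')
    (- 1 + eta / 2) ltac:(lra)).
  exists (Num.min a b) => [|s sT]; first by rewrite lt_min a0.
  by rewrite lt_min => /andP[sa sb]; rewrite aP// bP.
pose d0 := Num.min d1 (T - t1).
have d00 : 0 < d0 by rewrite lt_min d10 subr_gt0.
have d0T : d0 <= T - t1 by rewrite ge_min lexx orbT.
have d01 : d0 <= d1 by rewrite ge_min lexx.
have inA s : t1 <= s < t1 + d0 -> 0 <= s < T /\ `|s - t1| < d1.
  by move=> /andP[s1 s2]; rewrite ltr_norml; split; lra.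
have xi1 : -1 < XI (x t1) t1 < 0 by lra.
have xK := xi_in_funnel t10 xi1.
have step sg : `|sg| = 1 -> disturbance_bound (x t1) + l * (gamma0 - gammaoo) <
      sg * logit (XI (x t1) t1) * control_gain (x t1) ->
    exists2 d, 0 < d & forall t, t1 <= t < t1 + d ->
      sg * (r (x t) - r (x t1)) <= - (l * (gamma0 - gammaoo)) * (t - t1).
  move=> sg1; apply: (@barrier_step x V t1 d0 sg) => //.
  - apply: cvg_trans (xc t1 _); last by rewrite /= in_itv.
    apply: cvg_app; apply: within_subset => s /=; rewrite !in_itv/=.
    by move=> /inA[].
  - move=> t /[dup] /andP[t1t _] /inA[tT _] i.
    have [it ->] := xV _ tT i; have [_ ->] := xV _ t1T' i; split.
      apply: integrableS it => // s /=; rewrite !in_itv/= => /andP[/(le_trans t10) -> ->] //.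
    by rewrite -(Rintegral_increment t10 t1t it); ring.
  - by move=> s /inA[sT sd]; apply: VE => //; apply: d1P => //; rewrite in_itv.
(* At the upper wall the control makes [r] decrease, while the wall [rho_max - eta * gamma] does not
   descend. Strictly below the wall, continuity suffices. *)
have [a a0 aP] : exists2 d, 0 < d & forall s, t1 <= s < t1 + d -> s < T ->
    XI (x s) s <= - eta.
  move: hi; rewrite le_eqVlt => /predU1P[xiE|hi].
    have [||a a0 aP] := step 1; [by rewrite normr1|by rewrite mul1r xiE; exact: gain|].
    exists a => // s sa sT; have := aP _ sa; move: xiE; rewrite /xi mul1r.
    have /andP[s1 _] := sa.
    move=> /(canRL (mulfVK _)); rewrite gt_eqF ?gamma_gt0// => /(_ isT).
    rewrite ler_pdivrMr ?gamma_gt0//.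
    have := gamma_nonincreasing s1.
    have : 0 <= l * (gamma0 - gammaoo) * (s - t1) by rewrite !mulr_ge0 ?subr_ge0.
    nra.
  have [a a0 aP] := near_withinP (cvgr_lt (XI (x t1) t1) (xic _ t1T') _ hi).
  exists a => // s /andP[s1 s2] sT; apply/ltW/aP.
    by rewrite /= in_itv/= sT (le_trans t10).
  by rewrite ltr_norml; lra.
(* The lower wall may rise, so the sign of the increment is not enough: [r] must grow at least as
   fast as [gamma] shrinks, which is the rate provided by [step]. *)
have [b b0 bP] : exists2 d, 0 < d & forall s, t1 <= s < t1 + d -> s < T ->
    - 1 + eta <= XI (x s) s.
  move: lo; rewrite le_eqVlt => /predU1P[xiE|lo].
    have [||b b0 bP] := step (- 1); [by rewrite normrN1| |].
      rewrite mulN1r -xiE logitN ?opprK; last by lra.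
      exact: gain.
    exists b => // s sb sT; have := bP _ sb; move: xiE; rewrite /xi mulN1r.
    have /andP[s1 _] := sb.
    move=> /esym /(canRL (mulfVK _)); rewrite gt_eqF ?gamma_gt0// => /(_ isT).
    rewrite ler_pdivlMr ?gamma_gt0//.
    have := gamma_lipschitz t10 s1.
    have := gamma_nonincreasing s1.
    have : 0 <= l * (gamma0 - gammaoo) * (s - t1) by rewrite !mulr_ge0 ?subr_ge0.
    nra.
  have [b b0 bP] := near_withinP (cvgr_gt (XI (x t1) t1) (xic _ t1T') _ lo).
  exists b => // s /andP[s1 s2] sT; apply/ltW/bP.
    by rewrite /= in_itv/= sT (le_trans t10).
  by rewrite ltr_norml; lra.
exists (Num.min a b) => [|s /andP[s1]]; first by rewrite lt_min a0.
rewrite -ltrBlDl lt_min !ltrBlDl => /andP[sa sb] sT.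
by rewrite aP ?bP ?s1.
Qed.

End closed_loop.
End funnel.

(** * Robustness and truncation *)

Section robustness.
Variables (R : realType) (n : nat).
Implicit Types (psi : formula R n) (x : 'cV[R]_n).

Lemma rho_finite_or_pinfty psi :
  (forall x, rho psi x \is a fin_num) \/ (forall x, rho psi x = +oo%E).
Proof.
elim: psi => [|h|h|p1 IH1 p2 IH2] /=; [by right|by left|by left|].
case: IH1 => H1; case: IH2 => H2.
- left=> x; case: (rho p1 x) (H1 x) => // a _; case: (rho p2 x) (H2 x) => // b _.
  by rewrite /= leNgt addr_gt0 ?expR_gt0.
- left=> x; rewrite H2; case: (rho p1 x) (H1 x) => // a _.
  by rewrite /= addr0 leNgt expR_gt0.
- left=> x; rewrite H1; case: (rho p2 x) (H2 x) => // a _.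
  by rewrite /= add0r leNgt expR_gt0.
- by right=> x; rewrite H1 H2 /= addr0 lexx.
Qed.

(** A positive smooth conjunction means that the two exponentials sum to less than 1, so each is
    below 1 and both robustness values are positive. Strict positivity matters for negated
    predicates. *)
Lemma rho_gt0_holds psi x : (0 < rho psi x)%E -> holds psi x.
Proof.
elim: psi => [|h|h|p1 IH1 p2 IH2] //=.
- by rewrite lte_fin => /ltW.
- by rewrite lte_fin oppr_gt0 ltNge => /negP.
- move=> H; suff [H1 H2] : (0 < rho p1 x)%E /\ (0 < rho p2 x)%E by split; auto.
  have expR1 (a : R) : expR (- a) < 1 -> 0 < a.
    by rewrite -expR0 ltr_expR oppr_lt0.
  have ln1 (s : R) : 0 < s -> ln s < 0 -> s < 1.
    by move=> s0 ls; rewrite ltNge; apply/negP => /ln_ge0; rewrite leNgt ls.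
  move: H; case: (rho p1 x) => [a| |]; case: (rho p2 x) => [b| |] //=.
  + have ea := expR_gt0 (- a); have eb := expR_gt0 (- b).
    rewrite leNgt addr_gt0//= lte_fin oppr_gt0 => /(ln1 _ (addr_gt0 ea eb)) e1.
    by split; rewrite lte_fin; apply: expR1; lra.
  + have ea := expR_gt0 (- a).
    rewrite addr0 leNgt ea/= lte_fin oppr_gt0 => /(ln1 _ ea) e1.
    by split; rewrite ?ltry// lte_fin; apply: expR1.
  + have eb := expR_gt0 (- b).
    rewrite add0r leNgt eb/= lte_fin oppr_gt0 => /(ln1 _ eb) e1.
    by split; rewrite ?ltry// lte_fin; apply: expR1.
Qed.

End robustness.

Section clamp.
Variable R : realType.

Definition clamp (lo hi z : R) := Num.max lo (Num.min hi z).

Lemma clamp_id lo hi z : lo <= z <= hi -> clamp lo hi z = z.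
Proof. by move=> /andP[? ?]; rewrite /clamp min_r// max_r. Qed.

Lemma clamp_itv lo hi z : lo <= hi -> lo <= clamp lo hi z <= hi.
Proof. by move=> lohi; rewrite le_max lexx/= ge_max lohi ge_min lexx. Qed.

Lemma clamp_lipschitz lo hi y z : `|clamp lo hi y - clamp lo hi z| <= `|y - z|.
Proof.
have maxL (a b c : R) : `|Num.max a b - Num.max a c| <= `|b - c|.
  have := ler_norm (b - c); have := ler_norm (- (b - c)); rewrite normrN.
  have := normr_ge0 (b - c); move: `|b - c| => D ? ? ?.
  by rewrite ler_norml; case: (leP a b) => ?; case: (leP a c) => ?; lra.
have minL (a b c : R) : `|Num.min a b - Num.min a c| <= `|b - c|.
  have := ler_norm (b - c); have := ler_norm (- (b - c)); rewrite normrN.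
  have := normr_ge0 (b - c); move: `|b - c| => D ? ? ?.
  by rewrite ler_norml; case: (leP a b) => ?; case: (leP a c) => ?; lra.
exact: le_trans (maxL _ _ _) (minL _ _ _).
Qed.

Lemma cvg_clamp lo hi (T : Type) (F : set_system T) (FF : Filter F) (u : T -> R) z :
  u t @[t --> F] --> z -> clamp lo hi (u t) @[t --> F] --> clamp lo hi z.
Proof.
move=> /cvgrPdist_le uz; apply/cvgrPdist_le => e /uz; apply: filterS => t.
exact: le_trans (clamp_lipschitz _ _ _ _).
Qed.

End clamp.

(** The Lipschitz bound near [(x, x)] is used on pairs whose first component is [x]. *)
Lemma locally_lipschitz_continuous (R : realType) (V W : normedModType R)
    (h : V -> W) :
  [locally [lipschitz h x | x in [set: V]]] -> continuous h.
Proof.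
move=> hL x; have [//|M [_ HM]] := hL (x, x).
have {HM} : \forall z \near (x, x), `|h z.1 - h z.2| <= (`|M| + 1) * `|z.1 - z.2|.
  have := HM (`|M| + 1); rewrite (le_lt_trans (ler_norm M)) ?ltrDl// => /(_ isT).
  move=> H; have {}H : nbhs (x, x) [set z | ([set: V] `*` [set: V]) z ->
    `|h z.1 - h z.2| <= (`|M| + 1) * `|z.1 - z.2|] by exact: H.
  by apply: filterS H => z; apply.
move=> [[A B] /= [Ax Bx] AB].
apply/cvgrPdist_lt => e e0.
have k0 : 0 < `|M| + 1 by rewrite ltr_wpDl.
have Bx' : \forall y \near x, B y by [].
near=> y; apply: le_lt_trans (AB (x, y) _) _.
  by split => /=; [exact: nbhs_singleton|near: y].
rewrite /= -ltr_pdivlMl//; near: y; apply: cvgr_dist_lt; first exact: cvg_id.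
by rewrite mulr_gt0// invr_gt0.
Unshelve. all: by end_near. Qed.

(** * Margin of the funnel and extension of solutions *)

Section synthesis.
Variables (R : realType) (gamma0 gammaoo l : R).
Hypotheses (gammaoo_gt0 : 0 < gammaoo) (gammaoo_le : gammaoo <= gamma0).
Hypothesis l_ge0 : 0 <= l.
Variables (n m : nat) (f : 'cV[R]_n -> 'cV[R]_n) (g : 'cV[R]_n -> 'M[R]_(n, m)).
Variables (psi : formula R n) (rho_max : R).
Notation r := (rho_fin psi).
Notation XI := (xi psi rho_max gamma0 gammaoo l).
Notation drift := (drift f g psi).
Hypotheses (f_continuous : continuous f) (g_continuous : continuous g).
Hypothesis r_diff : forall x, differentiable r x.
Hypothesis r_concave : forall x y t, 0 <= t <= 1 ->
  t * r x + (1 - t) * r y <= r (t *: x + (1 - t) *: y).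

Lemma cvg_grad (S : Type) (F : set_system S) (FF : Filter F)
    (y : S -> 'cV[R]_n) (x : 'cV[R]_n) :
  y s @[s --> F] --> x -> grad r (y s) @[s --> F] --> grad r x.
Proof. by move=> yx; exact: (cvg_comp _ _ yx (@grad_continuous _ _ _ r_diff r_concave _)). Qed.

Lemma cvg_disturbance_bound (Wb : R) (S : Type) (F : set_system S)
    (FF : Filter F) (y : S -> 'cV[R]_n) (x : 'cV[R]_n) : y s @[s --> F] --> x ->
  disturbance_bound f psi Wb (y s) @[s --> F] --> disturbance_bound f psi Wb x.
Proof.
move=> yx; apply: cvg_big => [|i _]; first by move=> u; exact: add_continuous.
have fy : f (y s) @[s --> F] --> f x := cvg_comp _ _ yx (@f_continuous _).
apply: cvgM; first by apply: cvg_norm; apply: cvg_entry; exact: cvg_grad.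
by apply: cvgD; [apply: cvg_norm; exact: cvg_entry|exact: cvg_cst].
Qed.

Lemma cvg_control_gain (S : Type) (F : set_system S) (FF : Filter F)
    (y : S -> 'cV[R]_n) (x : 'cV[R]_n) : y s @[s --> F] --> x ->
  control_gain g psi (y s) @[s --> F] --> control_gain g psi x.
Proof.
move=> yx; have gy : g (y s) @[s --> F] --> g x := cvg_comp _ _ yx (@g_continuous _).
have Gy := cvg_grad FF yx.
apply: cvg_entry; apply: cvg_mulmx => //; apply: cvg_mulmx; first exact: cvg_trmx.
by apply: cvg_mulmx => //; exact: cvg_trmx.
Qed.

Lemma funnel_margin (Wb C : R) (x0 y : 'cV[R]_n) :
  (forall x, posdef (g x *m (g x)^T)) ->
  0 < rho_max -> rho_max < r y -> (forall x, 0 < r x -> `|x| <= C) ->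
  -1 < XI x0 0 < 0 ->
  exists eta, [/\ 0 < eta < 1 / 2, - 1 + eta <= XI x0 0 <= - eta &
    forall x, rho_max - gamma0 <= r x <= rho_max ->
      disturbance_bound f psi Wb x + l * (gamma0 - gammaoo) <
      logit (- eta) * control_gain g psi x].
Proof.
move=> ggP rm0 ry rC xi0.
have ry0 : 0 < r y by exact: lt_trans ry.
pose K := [set x | rho_max - gamma0 <= r x <= rho_max].
have clK : closed K.
  rewrite (_ : K = r @^-1` `[rho_max - gamma0, rho_max]); last first.
    by apply/seteqP; split => x /=; rewrite in_itv.
  apply: preimage_closed; last exact: interval_closed.
  by move=> x _; exact: concave_continuous.
have cK : compact K.
  apply: (subclosed_compact clK
    (@superlevel_compact _ _ _ r_diff r_concave _ _ ry0 rC (rho_max - gamma0))).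
  by move=> x /= /andP[].
have db_cont : continuous (disturbance_bound f psi Wb).
  by move=> x; apply: (@cvg_disturbance_bound Wb _ (nbhs x) _ id x); exact: cvg_id.
have cg_cont : continuous (control_gain g psi).
  by move=> x; apply: (@cvg_control_gain _ (nbhs x) _ id x); exact: cvg_id.
(* On [K] the robustness is below [r y], so the gradient does not vanish. *)
have cg_gt0 x : K x -> 0 < control_gain g psi x.
  move=> /andP[_ rx]; have [_ ] := ggP x; apply.
  by apply: (grad_neq0 r_diff r_concave (y := y)); exact: le_lt_trans ry.
have [K1 K1P] := continuous_le_compact db_cont cK.
have [q q0 qP] := continuous_gt0_compact cg_cont cK cg_gt0.
have L0 : 0 <= l * (gamma0 - gammaoo) by rewrite mulr_ge0 ?subr_ge0.
(* Chosen so that [M * q] exceeds the largest disturbance plus the contraction rate by at least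
   1. *)
pose M := (`|K1| + l * (gamma0 - gammaoo) + 1) / q.
have M0 : 0 < M by rewrite divr_gt0// ltr_wpDl// addr_ge0.
have [eta [eta0 eta1 Meta]] := logit_margin M0 xi0.
exists eta; split => // x Kx.
apply: (@lt_le_trans _ _ (M * control_gain g psi x)); last first.
  by rewrite ler_wpM2r// ltW// cg_gt0.
apply: (@lt_le_trans _ _ (M * q)); last by rewrite ler_wpM2l ?qP// ltW.
rewrite divfK ?gt_eqF//; have := K1P _ Kx; have := ler_norm K1; lra.
Qed.

(** * Continuation of a given solution by a bounded field *)

Section extension.
Variables (Wb M eta T : R) (w z : R -> 'cV[R]_n).
Hypotheses (eta_itv : 0 < eta < 1 / 2) (M_ge0 : 0 <= M).
Hypothesis w_bounded : forall s, 0 <= s -> `|w s| <= Wb.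
Hypothesis w_measurable : forall i,
  measurable_fun (`[0, +oo[%classic : set R) (fun s => w s i 0).
Hypothesis z_continuous : {within `[0, T[, continuous z}.

Definition box_proj (y : 'cV[R]_n) : 'cV[R]_n := \col_i clamp (- M) M (y i 0).

(* Bounded and continuous everywhere, unlike the closed-loop field. *)
Definition truncated_field (y : 'cV[R]_n) (s : R) : 'cV[R]_n :=
  drift (logit (clamp (- 1 + eta / 2) (- (eta / 2)) (XI (box_proj y) s)))
    (box_proj y).

Lemma box_proj_id y : `|y| <= M -> box_proj y = y.
Proof.
move=> yM; apply/colP => i; rewrite mxE clamp_id// -ler_norml.
exact: le_trans (normr_entry_le _ _ _) yM.
Qed.

Lemma box_proj_le y : `|box_proj y| <= M.
Proof.
apply: normr_mx_le => // i j; rewrite mxE ler_norml clamp_itv//.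
by move: M_ge0; lra.
Qed.

Let clamp_in y s : - 1 + eta / 2 <=
  clamp (- 1 + eta / 2) (- (eta / 2)) (XI (box_proj y) s) <= - (eta / 2).
Proof. by apply: clamp_itv; move: eta_itv; lra. Qed.

Lemma truncated_fieldE y s : `|y| <= M ->
  - 1 + eta / 2 <= XI y s <= - (eta / 2) ->
  truncated_field y s = drift (logit (XI y s)) y.
Proof. by move=> yM xiy; rewrite /truncated_field box_proj_id// clamp_id. Qed.

Lemma cvg_truncated_field (S : Type) (F : set_system S) (FF : Filter F)
    (u : S -> R) (y : S -> 'cV[R]_n) t x :
  u s @[s --> F] --> t -> y s @[s --> F] --> x ->
  truncated_field (y s) (u s) @[s --> F] --> truncated_field x t.
Proof.
move=> ut yx.
have Px : box_proj (y s) @[s --> F] --> box_proj x.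
  apply: cvg_mx => i j; under eq_fun do rewrite mxE; rewrite mxE.
  by apply: cvg_clamp; exact: cvg_entry.
apply: cvg_drift => //; apply: cvg_logit.
  by have := clamp_in x t; move: eta_itv; lra.
by apply: cvg_clamp; exact: cvg_xi.
Qed.

(** Clamping bounds the logit by [logit (- (eta / 2))] uniformly in time, which leaves a continuous
    function on a compact box. *)
Lemma truncated_field_bounded : exists B, forall y s, `|truncated_field y s| <= B.
Proof.
pose E := logit (- (eta / 2)).
pose h y : R := `|f y| + E * `|g y *m ((g y)^T *m grad r y)|.
have cvg_h (S : Type) (F : set_system S) (FF : Filter F) (y : S -> 'cV[R]_n) (x : 'cV[R]_n) :
    y s @[s --> F] --> x -> h (y s) @[s --> F] --> h x.
  move=> yx.
  have fy : f (y s) @[s --> F] --> f x := cvg_comp _ _ yx (@f_continuous _).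
  have gy : g (y s) @[s --> F] --> g x := cvg_comp _ _ yx (@g_continuous _).
  have Gy := cvg_grad FF yx.
  apply: cvgD; first exact: cvg_norm.
  apply: cvgM; first exact: cvg_cst.
  apply: cvg_norm; apply: cvg_mulmx => //; apply: cvg_mulmx => //.
  exact: cvg_trmx.
have h_cont : continuous h.
  by move=> x; apply: (@cvg_h _ (nbhs x) _ id x); exact: cvg_id.
have cbox : compact [set y : 'cV[R]_n | `|y| <= M].
  apply: compact_cV.
    exists M; split; first exact: num_real.
    by move=> N MN y /le_trans; apply; exact: ltW.
  apply: (preimage_closed (D := [set a | a <= M])); last exact: closed_le.
  by move=> y _; exact: norm_continuous.
have [B hB] := continuous_le_compact h_cont cbox.
exists B => y s; apply: le_trans (hB _ (box_proj_le y)).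
apply: le_trans (ler_normD _ _) _; rewrite lerD2l -scalemxAr normrZ normrN.
rewrite ler_wpM2r//; apply: logit_bound; first by move: eta_itv; lra.
exact: clamp_in.
Qed.

(* Before time T the field does not depend on the state: it is prescribed along the
   given solution z, so every solution of the new equation agrees with z there. *)
Definition extension_field (y : 'cV[R]_n) (s : R) : 'cV[R]_n :=
  truncated_field (if s < T then z s else y) s + w s.

Lemma cvg_extension_field (t : R) (S : Type) (F : set_system S) (FF : Filter F)
    (y : S -> 'cV[R]_n) (x : 'cV[R]_n) : y s @[s --> F] --> x ->
  extension_field (y s) t @[s --> F] --> extension_field x t.
Proof.
move=> yx; rewrite /extension_field.
apply: cvgD; last exact: cvg_cst.
case: ifP => _; first exact: cvg_cst.
by apply: cvg_truncated_field => //; exact: cvg_cst.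
Qed.

Lemma extension_exists (x0 : 'cV[R]_n) : exists x : R -> 'cV[R]_n,
  [/\ x 0 = x0, continuous x & forall t, 0 <= t -> forall i,
    (@lebesgue_measure R).-integrable `[0, t]
      (fun s => (extension_field (x s) s i 0)%:E) /\
    x t i 0 = x0 i 0 +
      \int[@lebesgue_measure R]_(s in `[0, t]) extension_field (x s) s i 0].
Proof.
have [B0 B0P] := truncated_field_bounded.
have tf0 (y : 'cV[R]_n) : 0 <= B0 by have := B0P y 0; exact: le_trans (normr_ge0 _).
have Wb0 : 0 <= Wb by have := w_bounded (lexx 0); exact: le_trans (normr_ge0 _).
apply: (@caratheodory_existence R n extension_field x0 (B0 + Wb)).
- move=> x s i s0; apply: le_trans (normr_entry_le _ _ _) _.
  by apply: le_trans (ler_normD _ _) _; rewrite lerD ?w_bounded.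
- by move=> s s0 x; apply: (@cvg_extension_field s _ (nbhs x) _ id x); exact: cvg_id.
- move=> y y_cont i.
  rewrite (_ : (fun s => _) = (fun s => truncated_field
    (if s < T then z s else y s) s i 0 + w s i 0)); last first.
    by apply/funext => s; rewrite mxE.
  apply: measurable_funD => //.
  have mpiece (D : set R) (v : R -> 'cV[R]_n) : measurable D ->
      {within D, continuous v} ->
      measurable_fun D (fun s => truncated_field (v s) s i 0).
    move=> mD /subspace_continuousP vD.
    apply: subspace_continuous_measurable_fun => //.
    apply/subspace_continuousP => s Ds; apply: cvg_entry.
    by apply: cvg_truncated_field; [exact: cvg_within|exact: vD].
  (* The field may jump at [T], so measurability is proved on each side separately. The maximum
     covers negative [T]. *)
  rewrite (_ : `[0, +oo[%classic = (`[0, T[ `|` `[Num.max 0 T, +oo[)%classic :> set R); last first.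
    apply/seteqP; split => s /=; rewrite !in_itv/= !andbT.
      by move=> s0; case: (ltP s T) => sT; [left; rewrite s0|right; rewrite ge_max s0].
    by move=> [/andP[]//|]; rewrite ge_max => /andP[].
  apply/measurable_funU => //; split.
    apply: (eq_measurable_fun (fun s => truncated_field (z s) s i 0)).
      by move=> s; rewrite inE/= in_itv/= => /andP[_ ->].
    exact: mpiece.
  apply: (eq_measurable_fun (fun s => truncated_field (y s) s i 0)).
    by move=> s; rewrite inE/= in_itv/= andbT ge_max => /andP[_]; rewrite leNgt => /negbTE ->.
  by apply: mpiece => //; exact: continuous_subspaceT.
- by rewrite addr_ge0//; exact: (tf0 x0).
Qed.

End extension.
End synthesis.

(** * Closed-loop behaviour *)

Theorem theorem1 (R : realType) (n m : nat)
    (f : 'cV[R]_n -> 'cV[R]_n) (g : 'cV[R]_n -> 'M[R]_(n, m))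
    (W : set 'cV[R]_n) (x0 : 'cV[R]_n)
    (a b : \bar R) (phi : temporal R n) (psi : formula R n)
    (rho_max gamma0 gammaoo l : R)
    (hW : bounded_set W)
    (hab : (0 <= a <= b)%E)
    (hphi : phi = Always a b psi \/ phi = Eventually a b psi)
    (hf : [locally [lipschitz f x | x in [set: 'cV[R]_n]]])
    (hg : [locally [lipschitz g x | x in [set: 'cV[R]_n]]])
    (hgg : forall x, posdef (g x *m (g x)^T))
    (hrho_diff : forall x, differentiable (rho_fin psi) x)
    (hrho_concave : concave (rho psi))
    (hpsi : well_posed psi)
    (hopt : (0 < rho_opt psi)%E)
    (hgamma0 : 0 < gamma0) (hgammaoo : 0 < gammaoo)
    (hgamma : gammaoo <= gamma0) (hl : 0 <= l)
    (hxi : -1 < xi psi rho_max gamma0 gammaoo l x0 0 < 0)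
    (hmax : (Order.max 0 (rho psi x0) < rho_max%:E < rho_opt psi)%E) :
  let solution := closed_loop_solution f g psi rho_max gamma0 gammaoo l in
  let gam := gamma gamma0 gammaoo l in
  forall w : R -> 'cV[R]_n, noise W w ->
  [/\ exists x, solution w x0 `[0, +oo[%classic x,
      forall (T : R) (x : R -> 'cV[R]_n), solution w x0 `[0, T[%classic x ->
        exists2 y, solution w x0 `[0, +oo[%classic y & {in `[0, T[, y =1 x} &
      forall x : R -> 'cV[R]_n, solution w x0 `[0, +oo[%classic x ->
        (forall t, 0 <= t ->
           ((- gam t + rho_max)%:E < rho psi (x t) < rho_max%:E)%E) /\
        [/\ continuous_and_bounded x,
            continuous_and_bounded
              (fun t => xi psi rho_max gamma0 gammaoo l (x t) t),
            continuous_and_bounded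
              (fun t => epsilon psi rho_max gamma0 gammaoo l (x t) t) &
            continuous_and_bounded
              (fun t => control g psi rho_max gamma0 gammaoo l (x t) t)]].
Proof.
move=> solution gam w [wW w_meas].
have [rx0 rmopt] := andP hmax.
have rm0 : 0 < rho_max by move: rx0; rewrite gt_max => /andP[]; rewrite lte_fin.
(* The bound [rho psi x0 < rho_max] excludes the constant robustness [+oo]. *)
have rho_fin_num x : rho psi x \is a fin_num.
  have [//|psioo] := rho_finite_or_pinfty psi.
  by move: rx0; rewrite psioo gt_max => /andP[_]; rewrite ltNge leey.
pose r := rho_fin psi.
have rhoE x : rho psi x = (r x)%:E by rewrite /r /rho_fin fineK.
have r_concave x y t : 0 <= t <= 1 ->
    t * r x + (1 - t) * r y <= r (t *: x + (1 - t) *: y).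
  by move=> t01; have := hrho_concave x y t t01; rewrite !rhoE -!EFinM -EFinD lee_fin.
have [y rmy] : exists y, rho_max < r y.
  have [_ [y _ <-]] := ereal_sup_gt rmopt.
  by rewrite rhoE lte_fin => ?; exists y.
have [C rC] : exists C, forall x, 0 < r x -> `|x| <= C.
  (* Well-posedness is applied to the constant signal at [x]. *)
  have [C HC] := hpsi; exists C => x rx; apply: (HC (fun=> x)).
  by apply: rho_gt0_holds; rewrite rhoE lte_fin.
have f_cont := locally_lipschitz_continuous hf.
have g_cont := locally_lipschitz_continuous hg.
have [Wb w_bounded] : exists Wb, forall s, 0 <= s -> `|w s| <= Wb.
  have [M [_ HM]] := hW; exists (M + 1) => s s0.
  by apply: HM; [rewrite ltrDl|exact: wW].
have [eta [eta_itv xi0 gain]] := @funnel_margin R gamma0 gammaoo l hgamma hl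
  n m f g psi rho_max f_cont g_cont hrho_diff r_concave Wb C x0 y hgg rm0 rmy rC hxi.
have inv := @funnel_invariant R gamma0 gammaoo l hgammaoo hgamma hl n m f g psi
  rho_max Wb w f_cont g_cont hrho_diff r_concave w_bounded _ eta x0 _ _ eta_itv
  xi0 gain.
have ry0 : 0 < r y by exact: lt_trans rmy.
have [M' HM'] := superlevel_bounded r_concave ry0 rC (rho_max - gamma0).
pose M := `|M'|.
have M0 : 0 <= M by exact: normr_ge0.
pose XI := xi psi rho_max gamma0 gammaoo l.
have xi_le x t : 0 <= t -> -1 < XI x t < 0 -> `|x| <= M.
  move=> t0 xi01; apply: le_trans (ler_norm _); apply: HM'.
  by have /andP[] := xi_in_funnel hgammaoo hgamma hl t0 xi01.
have sol_xi T x : solution w x0 `[0, T[%classic x ->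
    forall t, 0 <= t < T -> - 1 + eta <= XI (x t) t <= - eta.
  move=> [x00 xc xV]; apply: (inv T x _ x00 xc _ (fun s _ _ => erefl)).
  by move=> t tT i; have [] := xV t _ i; rewrite /= ?in_itv.
have ext T z : solution w x0 `[0, T[%classic z ->
    exists2 x, solution w x0 `[0, +oo[%classic x & {in `[0, T[, x =1 z}.
  move=> zsol; have [z0 zc zV] := zsol.
  have [x [x00 xc xV]] := @extension_exists R gamma0 gammaoo l hgammaoo hgamma n m
    f g psi rho_max f_cont g_cont hrho_diff r_concave Wb M eta T w z eta_itv M0
    w_bounded w_meas zc x0.
  have truncE u s : 0 <= s -> - 1 + eta / 2 < XI u s < - (eta / 2) ->
      truncated_field gamma0 gammaoo l f g psi rho_max M eta u s =
      f u + g u *m control g psi rho_max gamma0 gammaoo l u s.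
    move=> s0 xius; rewrite truncated_fieldE//; last by move: xius; rewrite -/XI; lra.
    by apply: (xi_le _ s) => //; move: xius eta_itv; lra.
  (* Before [T] the given solution stays in the inner funnel, where truncation is inactive; so [x]
     and [z] are primitives of the same function with the same initial value. *)
  have xz t : 0 <= t < T -> x t = z t.
    move=> tT; apply/colP => i; have [t0 tT'] := andP tT.
    have zi : `[0, T[%classic t by rewrite /= in_itv.
    have [_ ->] := zV t zi i.
    suff [] : (@lebesgue_measure R).-integrable `[0, t]
        (fun s => ((f (z s) + g (z s) *m control g psi rho_max gamma0 gammaoo l (z s) s +
          w s) i 0)%:E) /\ x t i 0 = x0 i 0 + \int[@lebesgue_measure R]_(s in `[0, t])
        (f (z s) + g (z s) *m control g psi rho_max gamma0 gammaoo l (z s) s + w s) i 0.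
      by [].
    apply: eq_integral_equation (xV t t0 i) => s /andP[s0 st].
    have sT : s < T by exact: le_lt_trans tT'.
    rewrite /extension_field sT truncE//.
    have := sol_xi _ _ zsol s; rewrite s0 sT => /(_ isT).
    by move: eta_itv; lra.
  pose V s := truncated_field gamma0 gammaoo l f g psi rho_max M eta (x s) s + w s.
  have extE s : 0 <= s ->
      extension_field gamma0 gammaoo l f g psi rho_max M eta T w z (x s) s = V s.
    move=> s0; rewrite /extension_field /V; have [sT|_] := ltP s T; last by [].
    by have -> : x s = z s by apply: xz; rewrite s0 sT.
  have xVV t : 0 <= t -> forall i,
      (@lebesgue_measure R).-integrable `[0, t] (fun s => (V s i 0)%:E) /\
      x t i 0 = x0 i 0 + \int[@lebesgue_measure R]_(s in `[0, t]) V s i 0.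
    move=> t0 i; apply: eq_integral_equation (xV t t0 i) => s /andP[s0 _].
    by rewrite extE.
  (* Now [x] solves the truncated equation on all nonnegative times. Invariance keeps it in the
     inner funnel, where that equation is the closed-loop one. *)
  have xxi (t : R) : 0 <= t -> - 1 + eta <= XI (x t) t <= - eta.
    move=> t0; apply: (inv (t + 1) x V x00 (continuous_subspaceT xc)).
    - by move=> u /andP[u0 _]; exact: xVV.
    - by move=> s /andP[s0 _] xis; rewrite /V truncE.
    - by rewrite t0 ltrDl ltr01.
  exists x; last by move=> t /[!in_itv]/=; exact: xz.
  split => //; first exact: continuous_subspaceT.
  move=> t /=; rewrite in_itv/= andbT => t0 i.
  have VE s : 0 <= s -> V s =
      f (x s) + g (x s) *m control g psi rho_max gamma0 gammaoo l (x s) s + w s.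
    by move=> s0; rewrite /V truncE//; have := xxi s s0; move: eta_itv; lra.
  by apply: eq_integral_equation (xVV t t0 i) => s /andP[s0 _]; rewrite VE.
split=> [||x xsol]; last 1 first.
- have [x00 xc xV] := xsol.
  have xxi (t : R) : 0 <= t -> - 1 + eta <= XI (x t) t <= - eta.
    move=> t0; apply: (sol_xi (t + 1)); last by rewrite t0 ltrDl ltr01.
    split => //.
      apply: continuous_subspaceW xc => s /=; rewrite !in_itv/= andbT.
      by case/andP.
    by move=> s /=; rewrite in_itv/= => /andP[s0 _]; apply: xV; rewrite /= in_itv/= s0.
  have xi01 (t : R) : 0 <= t -> -1 < XI (x t) t < 0.
    by move=> /xxi; move: eta_itv; lra.
  pose D : set R := `[0, +oo[%classic.
  have xct (t : R) : 0 <= t ->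
      x s @[s --> within D (nbhs t)] --> x t.
    by move=> t0; move/subspace_continuousP : xc; apply; rewrite /= in_itv/= t0.
  have xict (t : R) : 0 <= t ->
      XI (x s) s @[s --> within D (nbhs t)] --> XI (x t) t.
    by move=> t0; apply: cvg_xi => //; [exact: cvg_within|exact: xct].
  have epsct (t : R) : 0 <= t -> logit (XI (x s) s)
      @[s --> within D (nbhs t)] --> logit (XI (x t) t).
    by move=> t0; apply: cvg_logit; [exact: xi01|exact: xict].
  have cvg_gG (S : Type) (F : set_system S) (FF : Filter F) (z : S -> 'cV[R]_n)
      (u : 'cV[R]_n) : z s @[s --> F] --> u ->
      (g (z s))^T *m grad r (z s) @[s --> F] --> (g u)^T *m grad r u.
    move=> zu; apply: cvg_mulmx; last exact: cvg_grad.
    by apply: cvg_trmx; exact: (cvg_comp _ _ zu (@g_cont _)).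
  have cab (V : normedModType R) (s : R -> V) (B : R) :
      (forall t : R, 0 <= t -> s u @[u --> within D (nbhs t)] --> s t) ->
      (forall t : R, 0 <= t -> `|s t| <= B) -> continuous_and_bounded s.
    move=> sc sB; split.
      by apply/subspace_continuousP => t /=; rewrite in_itv/= andbT; exact: sc.
    exists B; split; first exact: num_real.
    move=> N BN t /=; rewrite in_itv/= andbT => t0.
    exact: le_trans (sB _ t0) (ltW BN).
  have xM (t : R) : 0 <= t -> `|x t| <= M by move=> t0; exact: (xi_le _ t t0 (xi01 t t0)).
  have epsB (t : R) : 0 <= t -> `|logit (XI (x t) t)| <= logit (- eta).
    by move=> t0; apply: logit_bound; [move: eta_itv; lra|exact: xxi].
  split.
    move=> t t0; rewrite rhoE !lte_fin.
    have := xi01 t t0; rewrite /XI /xi -/r -/gam.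
    have g0 : 0 < gam t by exact: gamma_gt0.
    by rewrite ltr_pdivlMr// ltr_pdivrMr// => /andP[? ?]; apply/andP; split; lra.
  split.
  + exact: cab xct xM.
  + apply: (cab _ _ 1 xict) => t /xi01 /andP[? ?].
    by rewrite ler_norml; apply/andP; split; apply: ltW => //; lra.
  + exact: cab epsct epsB.
  + have h_cont : continuous (fun u => `|(g u)^T *m grad r u|).
      move=> u; have gGu : (g v)^T *m grad r v @[v --> u] --> (g u)^T *m grad r u.
        by apply: (@cvg_gG _ (nbhs u) _ id u); exact: cvg_id.
      exact: cvg_norm gGu.
    (* The path stays in a compact superlevel set, which bounds [g^T grad r]; the logit is bounded
       by the margin. *)
    have [B HB] := continuous_le_compact h_cont
      (@superlevel_compact _ _ _ hrho_diff r_concave _ _ ry0 rC (rho_max - gamma0)).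
    apply: (cab _ _ (logit (- eta) * B)) => t t0.
      by apply: cvgZ; [apply: cvgN; exact: epsct|apply: cvg_gG; exact: xct].
    rewrite /control normrZ normrN; apply: ler_pM => //; first exact: epsB.
    apply: HB => /=.
    by have /andP[] := xi_in_funnel hgammaoo hgamma hl t0 (xi01 t t0).
(* Global existence is the extension from [T = 0]: on the empty interval only the initial value is
   required. *)
- have [|x xsol _] := ext 0 (fun=> x0); last by exists x.
  split => //; first by apply: continuous_subspaceT => t; exact: cvg_cst.
  by move=> t /=; rewrite in_itv/= => /andP[t0 /(le_lt_trans t0)]; rewrite ltxx.
- exact: ext.
Qed.
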